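(* Let $\phi$ be a non-elliptic (i.e. hyperbolic or parabolic) automorphism of $\mathbb{D}$, let $a\in\mathbb{T}$ with $\phi(a)\neq a$, and let $\mu$ be a discrete positive measure on $\mathbb{T}$ with $atom(\mu)=Orb_\phi(a)$. Then $S_\mu$ is an eigenfunction of $C_\phi$ if and only if $\mu$ is of the form $$\mu=\sum_{n\in\mathbb{Z}}a_n\,\delta_{\phi^{[n]}(a)},$$ where $a_0>0$ and, for $n\in\mathbb{N}$ $(n\ge 1)$, $$a_n=a_0\prod_{k=0}^{n-1}\left|\phi'\left(\phi^{[k]}(a)\right)\right|\qquad\text{and}\qquad a_{-n}=\frac{a_0}{\prod_{k=1}^{n}\left|\phi'\left(\phi^{[-k]}(a)\right)\right|}.$$
   Context: $\mathbb{D}$ is the open unit disk and $\mathbb{T}$ the unit circle. An automorphism of $\mathbb{D}$ is a biholomorphic self-map of $\mathbb{D}$; it extends analytically across $\mathbb{T}$ and to a bijection of $\mathbb{T}$. A non-identity automorphism is hyperbolic if it has exactly two fixed points on $\mathbb{T}$, parabolic if it has exactly one fixed point on $\mathbb{T}$ (and none in $\mathbb{D}$), elliptic if it has exactly one fixed point in $\mathbb{D}$. For $k\in\mathbb{Z}$, $\phi^{[k]}$ is the $k$-th iterate of $\phi$ (iterates of $\phi^{-1}$ for negative $k$), and $Orb_\phi(a)=\{\phi^{[k]}(a):k\in\mathbb{Z}\}$. A positive measure $\mu$ on $\mathbb{T}$ is discrete if there is a countable $A\subset\mathbb{T}$ with $\mu(\mathbb{T}\setminus A)=0$; $atom(\mu)=\{w\in\mathbb{T}:\mu(\{w\})>0\}$.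 $\delta_p$ is the Dirac measure at $p$. $C_\phi f=f\circ\phi$ is the composition operator on the Hardy space $H^2(\mathbb{D})$. For a finite positive Borel measure $\mu$ on $\mathbb{T}$, $S_\mu(z)=\exp\left(-\int_{\mathbb{T}}\frac{t+z}{t-z}\,d\mu(t)\right)$, $z\in\mathbb{D}$. The measure $\mu$ in the claim is not assumed finite a priori (only that each point has finite mass): ''$S_\mu$ is an eigenfunction of $C_\phi$'' means that $\mu(\mathbb{T})<\infty$ (so that $S_\mu$ is defined) and $S_\mu\circ\phi=\lambda S_\mu$ for some constant $\lambda$. *)

(* Defs.v *)
From HB Require Import structures.
From mathcomp Require Import all_boot all_order all_algebra.
From mathcomp Require Import complex.
From mathcomp Require Import all_classical all_reals all_analysis.

Set Implicit Arguments.
Unset Strict Implicit.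
Unset Printing Implicit Defensive.

Import Order.TTheory GRing.Theory Num.Theory.
Import numFieldNormedType.Exports.

Local Open Scope classical_set_scope.
Local Open Scope ring_scope.
Local Open Scope complex_scope.

(* R[i] carries no topology in the libraries; it gets the one of its modulus,
   as a normed space over itself, so that [derivable f z 1] and [derive1 f z]
   are complex differentiability and the complex derivative. *)
HB.instance Definition _ (R : rcfType) := PseudoPointedMetric.copy R[i] R[i]^o.
HB.instance Definition _ (R : rcfType) := NormedModule.copy R[i] R[i]^o.

Section Disc.
Variable R : realType.
Implicit Types (phi f : R[i] -> R[i]) (U : set R[i]).

Definition disc : set R[i] := [set z | `|z| < 1].
Definition circle : set R[i] := [set z | `|z| = 1].
Definition closed_disc : set R[i] := [set z | `|z| <= 1].

(* To be used with U open. *)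
Definition holomorphic U f := forall z, U z -> derivable f z 1.

(* phi stands for an automorphism of the disc together with its analytic
   extension across the circle; its values away from the closed disc are
   irrelevant. *)
Definition disc_automorphism phi :=
  [/\ set_bij disc disc phi,
      holomorphic disc phi,
      holomorphic disc (pinv disc phi) &
      exists U, [/\ open U, closed_disc `<=` U & holomorphic U phi]].

Definition non_identity phi := ~ (forall z, disc z -> phi z = z).

Definition hyperbolic phi :=
  non_identity phi /\
  exists p q, p <> q /\ [set t | circle t /\ phi t = t] = [set p; q].

Definition parabolic phi :=
  [/\ non_identity phi,
      exists p, [set t | circle t /\ phi t = t] = [set p] &
      [set z | disc z /\ phi z = z] = set0].

(* Iterates of phi as a self-map of the closed disc. *)
Definition iterz phi (k : int) : R[i] -> R[i] :=
  match k with
  | Posz n => iter n phi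
  | Negz n => iter n.+1 (pinv closed_disc phi)
  end.

Definition Orb phi (a : R[i]) : set R[i] := range (fun k => iterz phi k a).

Definition cexp (z : R[i]) : R[i] :=
  (expR (complex.Re z))%:C * (cos (complex.Im z) +i* sin (complex.Im z)).

End Disc.

Arguments disc {R}.
Arguments circle {R}.
Arguments closed_disc {R}.

Definition borelC (R : realType) := g_sigma_algebraType (@open R[i]).

Section CircleMeasures.
Variable R : realType.
Implicit Types (mu : {measure set (borelC R) -> \bar R}) (phi : R[i] -> R[i]).

(* A Borel measure on the circle is a Borel measure on the plane which does
   not charge the complement of the circle. *)
Definition on_circle mu := mu (~` circle) = 0%E.

Definition discrete_measure mu :=
  exists A : set R[i],
    [/\ countable A, A `<=` circle & mu (circle `\` A) = 0%E].

Definition atom mu : set R[i] := [set w | circle w /\ (0 < mu [set w])%E].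

Definition cintegral mu (D : set R[i]) (f : R[i] -> R[i]) : R[i] :=
  (\int[mu]_(t in D) complex.Re (f t)) +i* (\int[mu]_(t in D) complex.Im (f t)).

Definition singular_function mu (z : R[i]) : R[i] :=
  cexp (- cintegral mu circle (fun t => (t + z) / (t - z))).

Definition composition phi (f : R[i] -> R[i]) : R[i] -> R[i] := f \o phi.

(* Finiteness of mu is part of the property: it is what makes the singular
   function meaningful, since [Rintegral] is a total operator.  When mu is
   finite that function is bounded by 1 and nowhere zero on the disc, hence a
   nonzero element of the Hardy space. *)
Definition singular_eigenfunction mu phi :=
  (mu circle < +oo)%E /\
  exists lambda : R[i], forall z, disc z ->
    composition phi (singular_function mu) z = lambda * singular_function mu z.

End CircleMeasures.

(* Main.v *)
(* An automorphism of the disc is a Moebius map (Schwarz's lemma, which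
   rests here on Goursat's lemma for rectangles and the mean value property),
   and |S_mu| = exp (- P[mu]) for the Poisson integral P[mu].

   If S_mu is an eigenfunction then P[mu] \o phi - P[mu] is constant on the disc.
   Since (1 - |z|^2) P[mu](z) tends to 4 mu {w} when z tends radially to w, and
   1 - |phi z|^2 = |phi' z| (1 - |z|^2), comparing the limits for z and phi z
   gives mu {phi w} = |phi' w| mu {w}; this is the recursion for the weights.

   Conversely, this recursion and the covariance of the Poisson kernel make
   the integral of the Herglotz kernel (t + z) / (t - z) invariant under
   z |-> phi z up to an additive constant.  Finiteness of mu comes from a fixed
   point p on the circle: p / (p - t) turns phi into an affine map of a line,
   along which the weights are a Riemann sum of 1 / (1/4 + y^2). *)

Require Import Defs.
From HB Require Import structures.
From mathcomp Require Import all_boot all_order all_algebra.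
From mathcomp Require Import complex.
From mathcomp Require Import all_classical all_reals all_analysis.
From mathcomp Require Import ring lra.
From mathcomp Require Import measurable_realfun.
Import Order.TTheory GRing.Theory Num.Theory.
Import numFieldNormedType.Exports.
Local Open Scope classical_set_scope.
Local Open Scope ring_scope.
Local Open Scope complex_scope.

(** * Complex differentiability *)

(** Holomorphy is bare pointwise derivability, with no continuity of the derivative, so every
    integral argument has to start from Goursat's lemma. What Schwarz's lemma needs is the maximum
    principle for f z / z, which is known to be only continuous at 0. The mean value property is
    therefore proved for functions with one exceptional centre, in logarithmic coordinates, where
    circles become vertical segments and the centre recedes to -oo. The Moebius form replaces
    boundary behaviour by algebra: on the circle conjugation is inversion, so that identities
    between moduli become rational identities. Two obstacles remain. The image of a radius under phi
    is not a radius, so the boundary limit that isolates an atom is stated for arbitrary sequences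
    in the disc, with the limit of (1 - |z|^2)^2 / |w - z|^2 as a parameter. And covariance of the
    Poisson kernel settles only real parts; its completion, the Herglotz kernel, picks up a term
    depending on t alone, and the eigenvalue is the exponential of minus the integral of that
    term. *)

Local Notation N := (@ComplexField.Normc.normc _).

(* [z^*] is [Num.conj] or [conjc] according to the scope in which it occurs. *)
Local Notation "z ^#" := (conjc z) (at level 1, format "z ^#") : ring_scope.

Section Modulus.
Set Implicit Arguments.
Unset Strict Implicit.
Variable R : realType.
Implicit Types z w : R[i].

Lemma sqr_modE z : N z ^+ 2 = complex.Re z ^+ 2 + complex.Im z ^+ 2.
Proof. by case: z => x y /=; rewrite sqr_sqrtr // addr_ge0 // sqr_ge0. Qed.

Lemma mod_ge0 z : 0 <= N z.
Proof. by case: z => x y /=; exact: sqrtr_ge0. Qed.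

Lemma mod0 : N (0 : R[i]) = 0.
Proof. exact: ComplexField.Normc.normc0. Qed.

Lemma mod1 : N (1 : R[i]) = 1.
Proof. exact: ComplexField.Normc.normc1. Qed.

Lemma modM z w : N (z * w) = N z * N w.
Proof. exact: ComplexField.Normc.normcM. Qed.

Lemma modV z : N z^-1 = (N z)^-1.
Proof. exact: ComplexField.Normc.normcV. Qed.

Lemma modN z : N (- z) = N z.
Proof. exact: normcN. Qed.

Lemma modD z w : N (z + w) <= N z + N w.
Proof. exact: le_normcD. Qed.

Lemma modB z w : N (z - w) = N (w - z).
Proof. by rewrite -modN opprB. Qed.

Lemma modJ z : N z^# = N z.
Proof. by case: z => x y /=; rewrite sqrrN. Qed.

Lemma mod_real (x : R) : N x%:C = `|x|.
Proof. by rewrite /= expr0n addr0 sqrtr_sqr. Qed.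

Lemma mod_eq0 z : (N z == 0) = (z == 0).
Proof.
apply/eqP/eqP => [|->]; last exact: mod0.
exact: ComplexField.Normc.eq0_normc.
Qed.

Lemma mod_gt0 z : (0 < N z) = (z != 0).
Proof. by rewrite lt0r mod_eq0 mod_ge0 andbT. Qed.

Lemma mod_le1 z : N z = 1 -> N z <= 1.
Proof. by move=> ->. Qed.

Lemma mod_dist z w : N z - N w <= N (z - w).
Proof. by rewrite lerBlDr -{1}(subrK w z) modD. Qed.

Lemma Re_le_mod z : `|complex.Re z| <= N z.
Proof.
rewrite -(ler_pXn2r (ltn0Sn 1)) ?nnegrE ?mod_ge0 // sqr_modE real_normK ?num_real //.
by rewrite lerDl sqr_ge0.
Qed.

Lemma Im_le_mod z : `|complex.Im z| <= N z.
Proof.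
rewrite -(ler_pXn2r (ltn0Sn 1)) ?nnegrE ?mod_ge0 // sqr_modE real_normK ?num_real //.
by rewrite lerDr sqr_ge0.
Qed.

Lemma mod_le_ReIm z : N z <= `|complex.Re z| + `|complex.Im z|.
Proof.
rewrite -(ler_pXn2r (ltn0Sn 1)) ?nnegrE ?mod_ge0 ?addr_ge0 // sqr_modE.
rewrite sqrrD !real_normK ?num_real //.
have := mulr_ge0 (normr_ge0 (complex.Re z)) (normr_ge0 (complex.Im z)).
lra.
Qed.

Lemma mulJ z : z * z^# = (N z ^+ 2)%:C.
Proof.
rewrite sqr_modE; case: z => x y; apply/eqP; rewrite eq_complex /=.
by apply/andP; split; apply/eqP; ring.
Qed.

Lemma discE z : disc z <-> N z < 1.
Proof. by rewrite /disc /= -ltcR. Qed.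

Lemma circleE z : circle z <-> N z = 1.
Proof. by rewrite /circle /=; split => [[]|zE] //; apply/eqP; rewrite eq_complex /= zE !eqxx. Qed.

Lemma closed_discE z : closed_disc z <-> N z <= 1.
Proof. by rewrite /closed_disc /= -lecR. Qed.

Lemma nbhs_modP (z : R[i]) (P : set R[i]) :
  nbhs z P <-> exists2 e : R, 0 < e & forall w, N (w - z) < e -> P w.
Proof.
split.
  move/nbhs_ballP => [e /= e0 H].
  have [f fE] : exists f : R, e = f%:C.
    exists (complex.Re e); apply/eqP; rewrite eq_complex /= eqxx /=.
    by move: e0; rewrite ltcE /= => /andP[].
  move: e0 H; rewrite fE ltcR => f0 H; exists f => // w wz; apply: H.
  by rewrite /ball /= /ball_ -[X in X < _]/((N (z - w))%:C) ltcR modB.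
move=> [e e0 H]; apply/nbhs_ballP; exists e%:C; first by rewrite /= ltcR.
move=> w; rewrite /ball /= /ball_ -[X in X < _]/((N (z - w))%:C) ltcR modB.
exact: H.
Qed.

Lemma cvg_modP (f : R[i] -> R[i]) (z l : R[i]) :
  f w @[w --> z] --> l <->
  forall e : R, 0 < e -> exists2 d : R, 0 < d &
    forall w, N (w - z) < d -> N (f w - l) < e.
Proof.
split.
  move=> fl e e0.
  have /fl/nbhs_modP[d d0 H] : nbhs l (fun w => N (w - l) < e).
    by apply/nbhs_modP; exists e.
  by exists d.
move=> H P /nbhs_modP[e e0 eP]; have [d d0 dH] := H _ e0.
by apply/nbhs_modP; exists d => // w /dH; exact: eP.
Qed.

Lemma cvg_cstC (c z : R[i]) : (fun=> c) w @[w --> z] --> c.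
Proof. by apply/cvg_modP => e e0; exists e => // w _; rewrite subrr mod0. Qed.

(* Unification does not find the filter instance of [nbhs z] in R[i], so that
   it is passed by hand. *)
Lemma cvgDC (f g : R[i] -> R[i]) (z l m : R[i]) :
  f w @[w --> z] --> l -> g w @[w --> z] --> m ->
  (f w + g w) @[w --> z] --> l + m.
Proof. exact: (@cvgD _ _ _ (nbhs z) (nbhs_filter z)). Qed.

Lemma cvgMC (f g : R[i] -> R[i]) (z l m : R[i]) :
  f w @[w --> z] --> l -> g w @[w --> z] --> m ->
  (f w * g w) @[w --> z] --> l * m.
Proof. exact: (@cvgM _ _ (nbhs z) (nbhs_filter z)). Qed.

Lemma cvgNC (f : R[i] -> R[i]) (z l : R[i]) :
  f w @[w --> z] --> l -> (- f w) @[w --> z] --> - l.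
Proof. exact: (@cvgN _ _ _ (nbhs z) (nbhs_filter z)). Qed.

Lemma cvgVC (f : R[i] -> R[i]) (z l : R[i]) :
  l != 0 -> f w @[w --> z] --> l -> (f w)^-1 @[w --> z] --> l^-1.
Proof. exact: (@cvgV _ _ (nbhs z) (nbhs_filter z)). Qed.

End Modulus.

Section ComplexDifferentiability.
Set Implicit Arguments.
Unset Strict Implicit.
Variable R : realType.
Implicit Types (f g : R[i] -> R[i]) (z w l : R[i]).

(* Caratheodory's form of differentiability. *)
Definition cdiff f z l := exists q : R[i] -> R[i],
  [/\ forall w, f w - f z = q w * (w - z), q z = l & q w @[w --> z] --> l].

Lemma derivable_cdiff f z : derivable f z 1 -> cdiff f z (derive1 f z).
Proof.
move=> fz; set l := derive1 f z.
exists (fun w => if w == z then l else (f w - f z) / (w - z)); split.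
- move=> w; case: eqVneq => [->|wz]; first by rewrite !subrr mulr0.
  by rewrite divfK // subr_eq0.
- by rewrite eqxx.
have fl : h^-1 *: ((f \o shift z) (h *: (1:R[i])) - f z) @[h --> 0^'] --> l.
  by rewrite /l derive1E; exact: fz.
apply/cvg_modP => e e0.
have /fl : nbhs l (fun w => N (w - l) < e) by apply/nbhs_modP; exists e.
rewrite /= nbhs_simpl /= /dnbhs /within /= => /nbhs_modP[d d0 H].
exists d => // w wd; case: eqVneq => [_|wz]; first by rewrite subrr mod0.
have := H (w - z); rewrite subr0 => /(_ wd); rewrite subr_eq0 => /(_ wz).
by rewrite /= scaler1 subrK mulrC.
Qed.

Lemma cdiff_eps f z l : cdiff f z l <->
  forall e : R, 0 < e -> exists2 d : R, 0 < d &
    forall h, N h < d -> N (f (z + h) - f z - l * h) <= e * N h.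
Proof.
split.
  move=> [q [qf qz /cvg_modP ql]] e e0; have [d d0 H] := ql _ e0.
  exists d => // h hd; rewrite qf addrAC subrr add0r -mulrBl modM.
  rewrite ler_wpM2r ?mod_ge0 //; apply/ltW/H.
  by rewrite addrAC subrr add0r.
move=> H; exists (fun w => if w == z then l else (f w - f z) / (w - z)); split.
- move=> w; case: eqVneq => [->|wz]; first by rewrite !subrr mulr0.
  by rewrite divfK // subr_eq0.
- by rewrite eqxx.
apply/cvg_modP => e e0.
have [d d0 dH] := H _ (divr_gt0 e0 (ltr0Sn R 1)); exists d => // w wd.
case: eqVneq => [_|wz]; first by rewrite subrr mod0.
have := dH _ wd; rewrite [z + _]addrC subrK => h.
have wz0 : w - z != 0 by rewrite subr_eq0.
have -> : (f w - f z) / (w - z) - l = (f w - f z - l * (w - z)) / (w - z).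
  by rewrite [RHS]mulrBl mulfK.
rewrite modM modV; apply: (@le_lt_trans _ _ (e / 2)).
  by rewrite ler_pdivrMr ?mod_gt0.
lra.
Qed.

Lemma cdiff_continuous f z l : cdiff f z l -> f w @[w --> z] --> f z.
Proof.
move=> [q [qf qz ql]].
have -> : f = (fun w => f z + q w * (w - z)).
  by apply/funext => w; rewrite -qf addrC subrK.
rewrite subrr mulr0 addr0 -[X in _ --> X]addr0 -(mulr0 l).
apply: cvgDC; first exact: cvg_cstC.
apply: (cvgMC ql); apply/cvg_modP => e e0; exists e => // w.
by rewrite subr0.
Qed.

(** A derivative is determined by the values along any set accumulating at the point. This
    identifies [derive1 phi] on the circle, where [phi] is compared with a Moebius map from inside
    the disc only. *)
Lemma cdiff_accumulation f g z l m : f z = g z ->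
  (forall d : R, 0 < d -> exists h, [/\ h != 0, N h < d & f (z + h) = g (z + h)]) ->
  cdiff f z l -> cdiff g z m -> l = m.
Proof.
move=> fgz fg /cdiff_eps H1 /cdiff_eps H2.
apply/eqP; rewrite -subr_eq0 -mod_eq0 eq_le mod_ge0 andbT.
apply/ler_addgt0Pl => e e0; rewrite addr0.
have e20 : 0 < e / 2 by lra.
have [d1 d10 {}H1] := H1 _ e20; have [d2 d20 {}H2] := H2 _ e20.
have [h [h0]] := fg (Num.min d1 d2) ltac:(by rewrite lt_min d10).
rewrite lt_min => /andP[/H1 {}H1 /H2 {}H2] E.
rewrite -(@ler_pM2r _ (N h)) ?mod_gt0 // -modM.
rewrite (_ : _ * h = (g (z + h) - g z - m * h) - (f (z + h) - f z - l * h)).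
  by apply: (le_trans (modD _ _)); rewrite modN; lra.
by rewrite E fgz; ring.
Qed.

Lemma cdiff_local f g z l (r : R) : 0 < r ->
  (forall w, N (w - z) < r -> f w = g w) -> cdiff f z l -> cdiff g z l.
Proof.
move=> r0 fg /cdiff_eps H; apply/cdiff_eps => e e0.
have [d d0 {}H] := H _ e0; exists (Num.min d r); first by rewrite lt_min d0.
move=> h; rewrite lt_min => /andP[hd hr].
rewrite -!fg ?subrr ?mod0 //; last by rewrite addrAC subrr add0r.
exact: H.
Qed.

Lemma cdiff_cst (c : R[i]) z : cdiff (fun=> c) z 0.
Proof.
by exists (fun=> 0); split=> // [w|]; [rewrite subrr mul0r|exact: cvg_cstC].
Qed.

Lemma cdiff_id z : cdiff (fun w => w) z 1.
Proof.
by exists (fun=> 1); split=> // [w|]; [rewrite mul1r|exact: cvg_cstC].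
Qed.

Lemma cdiffD f g z l m : cdiff f z l -> cdiff g z m ->
  cdiff (fun w => f w + g w) z (l + m).
Proof.
move=> [p [pf pz pl]] [q [qg qz ql]].
exists (fun w => p w + q w); split; last exact: cvgDC.
  by move=> w; rewrite mulrDl -pf -qg; ring.
by rewrite pz qz.
Qed.

Lemma cdiffM f g z l m : cdiff f z l -> cdiff g z m ->
  cdiff (fun w => f w * g w) z (l * g z + f z * m).
Proof.
move=> cf cg; have gc := cdiff_continuous cg.
move: cf cg => [p [pf pz pl]] [q [qg qz ql]].
exists (fun w => p w * g w + f z * q w); split.
- move=> w; rewrite mulrDl mulrAC -pf -mulrA -qg; ring.
- by rewrite pz qz.
exact: cvgDC (cvgMC pl gc) (cvgMC (@cvg_cstC _ _ z) ql).
Qed.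

Lemma cdiffV f z l : f z != 0 -> cdiff f z l ->
  cdiff (fun w => (f w)^-1) z (- l / f z ^+ 2).
Proof.
move=> fz cf; have fc := cdiff_continuous cf.
apply/cdiff_eps; move: cf => [q [qf qz ql]].
have H : (- q w / (f w * f z)) @[w --> z] --> - l / f z ^+ 2.
  rewrite expr2; apply: (cvgMC (cvgNC ql)); apply: cvgVC.
    by rewrite mulf_neq0.
  exact: cvgMC fc (@cvg_cstC _ _ z).
move=> e e0; have [d d0 dH] := (iffLR (cvg_modP _ _ _)) H _ e0.
have [d1 d10 d1H] := (iffLR (cvg_modP _ _ _)) fc (N (f z)) ltac:(by rewrite mod_gt0).
exists (Num.min d d1); first by rewrite lt_min d0.
move=> h; rewrite lt_min => /andP[hd hd1].
have zh : z + h - z = h by rewrite addrAC subrr add0r.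
have fzh : f (z + h) != 0.
  apply/eqP => f0; have := d1H (z + h); rewrite zh f0 sub0r modN ltxx.
  by move/(_ hd1).
have -> : (f (z + h))^-1 - (f z)^-1 - - l / f z ^+ 2 * h =
   (- q (z + h) / (f (z + h) * f z) - - l / f z ^+ 2) * h.
  have := qf (z + h); rewrite zh => E.
  rewrite mulrBl; congr (_ - _).
  rewrite mulrAC mulNr -E.
  by field; rewrite fz fzh.
rewrite modM ler_wpM2r ?mod_ge0 //; apply/ltW/dH; by rewrite zh.
Qed.

Lemma cdiff_comp f g z l m : cdiff g z m -> cdiff f (g z) l ->
  cdiff (f \o g) z (l * m).
Proof.
move=> cg; have gc := cdiff_continuous cg.
move: cg => [q [qg qz ql]] [p [pf pz pl]].
exists (fun w => p (g w) * q w); split.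
- by move=> w /=; rewrite pf qg mulrA.
- by rewrite pz qz.
apply: (cvgMC _ ql).
apply/cvg_modP => e e0; move/cvg_modP: pl => /(_ _ e0)[d d0 H].
move/cvg_modP: gc => /(_ _ d0)[d' d'0 H']; exists d' => // w /H'.
exact: H.
Qed.

End ComplexDifferentiability.

(** * Integrals over segments and Goursat's lemma *)

Section SegmentIntegral.
Set Implicit Arguments.
Unset Strict Implicit.
Variable R : realType.
Implicit Types (f g : R -> R) (a b c : R).
Notation leb := (@lebesgue_measure R).

Definition segint a b f : R := \int[leb]_(x in `[a, b]) f x.

(** Continuity is two-sided even at the endpoints: the integrands are defined beyond the segment,
    and passing to a subsegment costs nothing. *)
Definition continuous_on a b f := forall x, a <= x <= b -> {for x, continuous f}.

Lemma continuous_on_sub a b c d f :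
  a <= c -> d <= b -> continuous_on a b f -> continuous_on c d f.
Proof.
move=> ac db fc x /andP[cx xd]; apply: fc.
by rewrite (le_trans ac cx) (le_trans xd db).
Qed.

Lemma continuous_on_within a b f :
  continuous_on a b f -> {within `[a, b], continuous f}.
Proof.
move=> fc; apply: continuous_in_subspaceT => x.
by rewrite inE /= in_itv /=; exact: fc.
Qed.

Lemma segint_integrable a b f : continuous_on a b f ->
  leb.-integrable `[a, b] (EFin \o f).
Proof.
move=> /continuous_on_within fc.
by apply: continuous_compact_integrable => //; exact: segment_compact.
Qed.

Lemma segint_cat a b c f : a <= c -> c <= b -> continuous_on a b f ->
  segint a b f = segint a c f + segint c b f.
Proof.
move=> ac cb /segint_integrable fi.
have := @Rintegral_itvB R f (BLeft a) (BRight b) c fi ac cb.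
rewrite Rintegral_itv_obnd_cbnd; last first.
  apply: integrableS fi => //; apply: subset_itvr => /=.
  by rewrite bnd_simp.
by rewrite /segint => E; rewrite -[X in _ + X]E addrC subrK.
Qed.

Lemma segintD a b f g : continuous_on a b f -> continuous_on a b g ->
  segint a b (fun x => f x + g x) = segint a b f + segint a b g.
Proof.
by move=> /segint_integrable fi /segint_integrable gi; exact: RintegralD.
Qed.

Lemma segintB a b f g : continuous_on a b f -> continuous_on a b g ->
  segint a b (fun x => f x - g x) = segint a b f - segint a b g.
Proof.
by move=> /segint_integrable fi /segint_integrable gi; exact: RintegralB.
Qed.

Lemma segint_cst a b c : a <= b -> segint a b (fun=> c) = c * (b - a).
Proof.
move=> ab; rewrite /segint Rintegral_cst //= lebesgue_measure_itv /=.
rewrite lte_fin; case: ltP => [_|ba] //=.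
have -> : b = a by apply/eqP; rewrite eq_le ab ba.
by rewrite subrr.
Qed.

Lemma continuous_on_cst a b c : continuous_on a b (fun=> c).
Proof. by move=> x _; exact: cst_continuous. Qed.

Lemma segint_le a b f M : a <= b -> continuous_on a b f ->
  (forall x, a <= x <= b -> f x <= M) -> segint a b f <= M * (b - a).
Proof.
move=> ab fc fM; rewrite -segint_cst //; apply: (le_Rintegral _ (segint_integrable fc)
  (segint_integrable (@continuous_on_cst a b M))) => //.
Qed.

Lemma segint_ge a b f M : a <= b -> continuous_on a b f ->
  (forall x, a <= x <= b -> M <= f x) -> M * (b - a) <= segint a b f.
Proof.
move=> ab fc fM; rewrite -segint_cst //; apply:
  (le_Rintegral _ (segint_integrable (@continuous_on_cst a b M))
  (segint_integrable fc)) => //.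
Qed.

Lemma segint_norm_le a b f M : a <= b -> continuous_on a b f ->
  (forall x, a <= x <= b -> `|f x| <= M) -> `|segint a b f| <= M * (b - a).
Proof.
move=> ab fc fM; rewrite ler_norml -mulNr; apply/andP; split.
  by apply: segint_ge => // x /fM; rewrite ler_norml => /andP[].
by apply: segint_le => // x /fM; rewrite ler_norml => /andP[].
Qed.

(** If f c were positive, continuity would keep f above f c / 2 on a short segment to the right of
    c, and that segment alone would make the integral positive. *)
Lemma segint_ge0_eq0 a b f c : a < c < b -> continuous_on a b f ->
  (forall x, a <= x <= b -> 0 <= f x) -> segint a b f = 0 -> f c = 0.
Proof.
move=> /andP[ac cb] fc f0 I0; apply/eqP; rewrite eq_le; apply/andP; split; last first.
  by apply: f0; rewrite (ltW ac) (ltW cb).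
rewrite leNgt; apply/negP => fc0.
have /(_ c) := fc; rewrite (ltW ac) (ltW cb) => /(_ isT) /cvgrPdist_lt /(_ (f c / 2)).
have fc2 : 0 < f c / 2 by lra.
move=> /(_ fc2)/nbhs_ballP[d /= d0 H].
set u := Num.min (d / 2) (b - c); have u0 : 0 < u by rewrite lt_min; apply/andP; split; lra.
have cu : c + u <= b by rewrite -lerBrDl ge_min lexx orbT.
have ud : u <= d / 2 by rewrite ge_min lexx.
have fcs p q : a <= p -> q <= b -> continuous_on p q f.
  by move=> ap qb; exact: (@continuous_on_sub a b).
have E : segint a b f = segint a c f + (segint c (c + u) f + segint (c + u) b f).
  rewrite -(@segint_cat c b); [|lra|lra|apply: fcs; lra].
  by rewrite -(@segint_cat a b) //; lra.
have I1 : 0 <= segint a c f.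
  rewrite -(mul0r (c - a)); apply: segint_ge; [lra|apply: fcs; lra|].
  by move=> x /andP[ax xc]; apply: f0; rewrite ax /=; lra.
have I3 : 0 <= segint (c + u) b f.
  rewrite -(mul0r (b - (c + u))); apply: segint_ge; [lra|apply: fcs; lra|].
  by move=> x /andP[ax xc]; apply: f0; rewrite xc andbT; lra.
have : f c / 2 * (c + u - c) <= segint c (c + u) f.
  apply: segint_ge; [lra|apply: fcs; lra|].
  move=> x /andP[cx xcu].
  have := H x; rewrite /ball /= => /(_ ltac:(rewrite ltr_norml; lra)).
  by rewrite ltr_norml; lra.
have : 0 < f c / 2 * (c + u - c) by apply: mulr_gt0; lra.
lra.
Qed.

End SegmentIntegral.

Section Goursat.
Set Implicit Arguments.
Unset Strict Implicit.
Variable R : realType.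
Variables P Q : R -> R -> R.

(* The coefficient p2 is both dP/dy and dQ/dx: P dx + Q dy is closed there. *)
Definition closed_form_at (x0 y0 : R) := exists p1 p2 q2 : R,
  forall e : R, 0 < e -> exists2 d : R, 0 < d &
    forall x y, `|x - x0| < d -> `|y - y0| < d ->
      `|P x y - P x0 y0 - (p1 * (x - x0) + p2 * (y - y0))|
         <= e * (`|x - x0| + `|y - y0|) /\
      `|Q x y - Q x0 y0 - (p2 * (x - x0) + q2 * (y - y0))|
         <= e * (`|x - x0| + `|y - y0|).

(** Only these partial continuities matter: P is integrated along horizontal sides and Q along
    vertical ones. *)
Lemma closed_form_continuous x0 y0 : closed_form_at x0 y0 ->
  {for x0, continuous (fun x => P x y0)} /\ {for y0, continuous (Q x0)}.
Proof.
move=> [p1 [p2 [q2 H]]]; have [d d0 {}H] := H _ ltr01.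
split; apply/cvgrPdist_le => e e0; apply/nbhs_ballP.
  set K := `|p1| + 1; have K0 : 0 < K by rewrite ltr_wpDl.
  exists (Num.min d (e / K)); first by rewrite /= lt_min d0 divr_gt0.
  move=> x; rewrite /ball /= lt_min distrC => /andP[xd xe].
  have [+ _] := H x y0 xd ltac:(by rewrite subrr normr0).
  rewrite !subrr normr0 mulr0 addr0 addr0 mul1r => h.
  rewrite distrC -(subrK (p1 * (x - x0)) (P x y0 - P x0 y0)).
  apply: (le_trans (ler_normD _ _)); rewrite normrM.
  apply: (@le_trans _ _ (K * `|x - x0|)); last first.
    by rewrite mulrC -ler_pdivlMr // ltW.
  by rewrite /K mulrDl mul1r addrC lerD2l.
set K := `|q2| + 1; have K0 : 0 < K by rewrite ltr_wpDl.
exists (Num.min d (e / K)); first by rewrite /= lt_min d0 divr_gt0.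
move=> y; rewrite /ball /= lt_min distrC => /andP[xd xe].
have [_ +] := H x0 y ltac:(by rewrite subrr normr0) xd.
rewrite !subrr normr0 mulr0 add0r add0r mul1r => h.
rewrite distrC -(subrK (q2 * (y - y0)) (Q x0 y - Q x0 y0)).
apply: (le_trans (ler_normD _ _)); rewrite normrM.
apply: (@le_trans _ _ (K * `|y - y0|)); last first.
  by rewrite mulrC -ler_pdivlMr // ltW.
by rewrite /K mulrDl mul1r addrC lerD2l.
Qed.

(** The circulation of P dx + Q dy, counterclockwise, around the rectangle with lower left corner
    (x, y) and sides a, b. *)
Definition bdint (x y a b : R) : R :=
  segint x (x + a) (P^~ y) - segint x (x + a) (P^~ (y + b)) +
  (segint y (y + b) (Q (x + a)) - segint y (y + b) (Q x)).

Variables X1 X2 Y1 Y2 : R.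
Hypothesis PQ : forall x y, X1 <= x <= X2 -> Y1 <= y <= Y2 -> closed_form_at x y.

Let inrect x y a b := [/\ X1 <= x, x + a <= X2, Y1 <= y & y + b <= Y2].

Lemma Pc x a y : X1 <= x -> x + a <= X2 -> Y1 <= y <= Y2 ->
  continuous_on x (x + a) (P^~ y).
Proof.
move=> h1 h2 h3 s /andP[s1 s2]; apply: (closed_form_continuous _).1.
by apply: PQ => //; lra.
Qed.

Lemma Qc y b x : Y1 <= y -> y + b <= Y2 -> X1 <= x <= X2 ->
  continuous_on y (y + b) (Q x).
Proof.
move=> h1 h2 h3 s /andP[s1 s2]; apply: (closed_form_continuous _).2.
by apply: PQ => //; lra.
Qed.

Lemma bdint_quarter x y a b : 0 <= a -> 0 <= b -> inrect x y (a + a) (b + b) ->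
  bdint x y (a + a) (b + b) =
  bdint x y a b + bdint (x + a) y a b + bdint x (y + b) a b +
  bdint (x + a) (y + b) a b.
Proof.
move=> a0 b0 [h1 h2 h3 h4].
have HP t : Y1 <= t <= Y2 ->
    segint x (x + (a + a)) (P^~ t) =
    segint x (x + a) (P^~ t) + segint (x + a) (x + a + a) (P^~ t).
  move=> ht; rewrite -addrA; apply: segint_cat; [lra|lra|].
  by apply: Pc => //; lra.
have HQ t : X1 <= t <= X2 ->
    segint y (y + (b + b)) (Q t) =
    segint y (y + b) (Q t) + segint (y + b) (y + b + b) (Q t).
  move=> ht; rewrite -addrA; apply: segint_cat; [lra|lra|].
  by apply: Qc => //; lra.
rewrite /bdint !HP; [|lra|lra]; rewrite !HQ; [|lra|lra].
rewrite !addrA; ring.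
Qed.

(** The affine part has no circulation: P s y - P s (y + b) is close to - p2 b and Q (x + a) t - Q x
    t to p2 a, and after integration the two contributions p2 a b cancel. Only the error terms, at
    most e (a + b) each, remain under the integrals. *)
Lemma bdint_small x0 y0 : closed_form_at x0 y0 -> forall e, 0 < e ->
  exists2 d, 0 < d & forall x y a b, inrect x y a b -> 0 <= a -> 0 <= b ->
    a + b < d -> x <= x0 <= x + a -> y <= y0 <= y + b ->
    `|bdint x y a b| <= e * (a + b) ^+ 2.
Proof.
move=> [p1 [p2 [q2 H]]] e e0.
have [d d0 {}H] := H _ (divr_gt0 e0 (ltr0Sn R 1)); exists d => //.
move=> x y a b [h1 h2 h3 h4] a0 b0 abd hx hy.
have PE s t : x <= s <= x + a -> y <= t <= y + b ->
    `|P s t - P x0 y0 - (p1 * (s - x0) + p2 * (t - y0))| <= e / 2 * (a + b).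
  move=> hs ht; have := H s t; case.
  - by rewrite ltr_norml; lra.
  - by rewrite ltr_norml; lra.
  move=> h _; apply: (le_trans h); rewrite ler_wpM2l //; first lra.
  by apply: lerD; rewrite ler_norml; lra.
have QE s t : x <= s <= x + a -> y <= t <= y + b ->
    `|Q s t - Q x0 y0 - (p2 * (s - x0) + q2 * (t - y0))| <= e / 2 * (a + b).
  move=> hs ht; have := H s t; case.
  - by rewrite ltr_norml; lra.
  - by rewrite ltr_norml; lra.
  move=> _ h; apply: (le_trans h); rewrite ler_wpM2l //; first lra.
  by apply: lerD; rewrite ler_norml; lra.
have Pcc t : Y1 <= t <= Y2 -> continuous_on x (x + a) (P^~ t) by exact: Pc.
have Qcc t : X1 <= t <= X2 -> continuous_on y (y + b) (Q t) by exact: Qc.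
have I1 : `|segint x (x + a) (fun s => (P s y - P s (y + b)) + p2 * b)|
   <= e * (a + b) * (x + a - x).
  apply: segint_norm_le; first lra.
    move=> s hs; apply: continuousD; last exact: cst_continuous.
    by apply: continuousB; apply: Pcc => //; lra.
  move=> s hs; have := PE s y hs ltac:(lra).
  have := PE s (y + b) hs ltac:(lra).
  by rewrite !ler_norml; lra.
have I2 : `|segint y (y + b) (fun t => (Q (x + a) t - Q x t) - p2 * a)|
   <= e * (a + b) * (y + b - y).
  apply: segint_norm_le; first lra.
    move=> s hs; apply: continuousB; last exact: cst_continuous.
    by apply: continuousB; apply: Qcc => //; lra.
  move=> s hs; have := QE x s ltac:(lra) hs.
  have := QE (x + a) s ltac:(lra) hs.
  by rewrite !ler_norml; lra.
move: I1 I2.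
have Pc1 : continuous_on x (x + a) (P^~ y) by apply: Pcc; lra.
have Pc2 : continuous_on x (x + a) (P^~ (y + b)) by apply: Pcc; lra.
have Qc1 : continuous_on y (y + b) (Q x) by apply: Qcc; lra.
have Qc2 : continuous_on y (y + b) (Q (x + a)) by apply: Qcc; lra.
rewrite segintD; last 2 first.
- by move=> s hs; apply: continuousB; [exact: Pc1|exact: Pc2].
- exact: continuous_on_cst.
rewrite (segintB Pc1 Pc2) segintB; last 2 first.
- by move=> s hs; apply: continuousB; [exact: Qc2|exact: Qc1].
- exact: continuous_on_cst.
rewrite (segintB Qc2 Qc1) !segint_cst; [|lra|lra].
rewrite /bdint.
set A1 := segint _ _ _; set A2 := segint _ _ _; set A3 := segint _ _ _.
set A4 := segint _ _ _ => I1 I2.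
have -> : A1 - A2 + (A3 - A4) = (A1 - A2 + p2 * b * (x + a - x)) +
   (A3 - A4 - p2 * a * (y + b - y)) by ring.
apply: (le_trans (ler_normD _ _)); apply: (le_trans (lerD I1 I2)).
by rewrite le_eqVlt; apply/orP; left; apply/eqP; ring.
Qed.

(** Bisection: a nonzero circulation would survive, relative to the squared size, in a nested
    sequence of quarters, against [bdint_small] at their common point. *)
Lemma goursat : X1 < X2 -> Y1 < Y2 -> bdint X1 Y1 (X2 - X1) (Y2 - Y1) = 0.
Proof.
move=> X12 Y12; apply/eqP; rewrite -normr_eq0 eq_le normr_ge0 andbT leNgt.
apply/negP => I0.
set a := X2 - X1; set b := Y2 - Y1.
have a0 : 0 < a by rewrite /a; lra.
have b0 : 0 < b by rewrite /b; lra.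
(* The ratio of circulation to squared size. Passing to a quarter divides the squared size by 4, and
   some quarter keeps a fourth of the circulation, so the bound with this [eta] is inherited. *)
set eta := `|bdint X1 Y1 a b| / (a + b) ^+ 2.
have ab0 : 0 < a + b by lra.
have eta0 : 0 < eta by rewrite divr_gt0 // exprn_gt0.
pose u (n : nat) : R := 2^-1 ^+ n.
have u0 n : 0 < u n by rewrite exprn_gt0 // invr_gt0.
have uS n : u n = u n.+1 + u n.+1 by rewrite /u exprS; field.
have auS n : a * u n = a * u n.+1 + a * u n.+1 by rewrite uS mulrDr.
have buS n : b * u n = b * u n.+1 + b * u n.+1 by rewrite uS mulrDr.
have au n : 0 < a * u n by rewrite mulr_gt0.
have bu n : 0 < b * u n by rewrite mulr_gt0.
pose bad (s : nat * (R * R)) := let: (n, (x, y)) := s in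
  inrect x y (a * u n) (b * u n) /\
  eta * (a * u n + b * u n) ^+ 2 <= `|bdint x y (a * u n) (b * u n)|.
pose next (s s' : {s | bad s}) :=
  let: (n, (x, y)) := sval s in let: (n', (x', y')) := sval s' in
  [/\ n' = n.+1, x <= x' <= x + a * u n.+1 & y <= y' <= y + b * u n.+1].
have bad0 : bad (0%N, (X1, Y1)).
  rewrite /bad /inrect /u expr0 !mulr1; split.
    by split; rewrite /a /b; lra.
  by rewrite /eta divfK // expf_neq0 // lt0r_neq0.
have step s : {s' | next s s'}.
  apply: cid; case: s => -[n [x y]] [[h1 h2 h3 h4] hI].
  have hu := au n.+1; have hv := bu n.+1.
  have E := @bdint_quarter x y (a * u n.+1) (b * u n.+1) (ltW hu) (ltW hv).
  have {}E := E ltac:(by split; rewrite -?auS -?buS).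
  rewrite -auS -buS in E.
  (* Turns a quarter with large circulation into the next rectangle; by the triangle inequality one
     of the four quarters qualifies. *)
  have mk x' y' : (x' = x \/ x' = x + a * u n.+1) ->
      (y' = y \/ y' = y + b * u n.+1) ->
      eta * (a * u n.+1 + b * u n.+1) ^+ 2 <=
        `|bdint x' y' (a * u n.+1) (b * u n.+1)| ->
      exists s' : {s | bad s},
        next (exist bad (n, (x, y)) (conj (And4 h1 h2 h3 h4) hI)) s'.
    move=> hx hy hI'.
    have hb : bad (n.+1, (x', y')).
      split => //; have := auS n; have := buS n => e1 e2.
      by case: hx => hx; case: hy => hy; split; lra.
    exists (exist _ _ hb); rewrite /next /=.
    by split=> //; [case: hx => hx|case: hy => hy]; lra.
  have [l1|l1] := leP (eta * (a * u n.+1 + b * u n.+1) ^+ 2)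
    `|bdint x y (a * u n.+1) (b * u n.+1)|; first by apply: (mk x y) => //; left.
  have [l2|l2] := leP (eta * (a * u n.+1 + b * u n.+1) ^+ 2)
    `|bdint (x + a * u n.+1) y (a * u n.+1) (b * u n.+1)|.
    by apply: (mk (x + a * u n.+1) y) => //; [right|left].
  have [l3|l3] := leP (eta * (a * u n.+1 + b * u n.+1) ^+ 2)
    `|bdint x (y + b * u n.+1) (a * u n.+1) (b * u n.+1)|.
    by apply: (mk x (y + b * u n.+1)) => //; [left|right].
  have [l4|l4] := leP (eta * (a * u n.+1 + b * u n.+1) ^+ 2)
    `|bdint (x + a * u n.+1) (y + b * u n.+1) (a * u n.+1) (b * u n.+1)|.
    by apply: (mk (x + a * u n.+1) (y + b * u n.+1)) => //; right.
  exfalso; move: (hI); rewrite E leNgt => /negP; apply.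
  have -> : eta * (a * u n + b * u n) ^+ 2 =
     4 * (eta * (a * u n.+1 + b * u n.+1) ^+ 2) by rewrite auS buS; ring.
  move: l1 l2 l3 l4; rewrite !ltr_norml; lra.
have [s [s0 sS]] := dependent_choice step (exist bad _ bad0).
pose x n := (sval (s n)).2.1; pose y n := (sval (s n)).2.2.
have sn n : (sval (s n)).1 = n.
  elim: n => [|n IH]; first by rewrite s0.
  move: (sS n) IH; rewrite /next.
  case: (s n) => -[m [? ?]] ?; case: (s n.+1) => -[m' [? ?]] ? /=.
  by move=> [-> _ _] ->.
have badn n : bad (n, (x n, y n)).
  move: (sn n); rewrite /x /y; case: (s n) => -[m [? ?]] h /= <-; exact: h.
have stepn n : x n <= x n.+1 <= x n + a * u n.+1 /\
               y n <= y n.+1 <= y n + b * u n.+1.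
  move: (sS n) (sn n); rewrite /next /x /y.
  case: (s n) => -[m [? ?]] ?; case: (s n.+1) => -[m' [? ?]] ? /=.
  by move=> [_ h1 h2] <-.
(* The corners increase and the opposite corners decrease, so the supremum lies in all the nested
   segments. *)
have lim (z : nat -> R) c : 0 < c ->
    (forall n, z n <= z n.+1 <= z n + c * u n.+1) ->
    exists l, forall n, z n <= l <= z n + c * u n.
  move=> c0 zS; exists (sup (range z)) => n.
  have zmono m k : z m <= z (m + k)%N.
    elim: k => [|k IH]; first by rewrite addn0.
    by rewrite addnS (le_trans IH) //; have /andP[] := zS (m + k)%N.
  have zup m k : z (m + k)%N + c * u (m + k)%N <= z m + c * u m.
    elim: k => [|k IH]; first by rewrite addn0.
    rewrite addnS; apply: le_trans IH.
    by have /andP[_] := zS (m + k)%N; rewrite (uS (m + k)%N) mulrDr; lra.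
  have zz m k : z m <= z k + c * u k.
    have := mulr_gt0 c0 (u0 k); have := mulr_gt0 c0 (u0 m) => h1 h2.
    case: (leqP m k) => mk.
      have := zmono m (k - m)%N; rewrite subnKC //; lra.
    have := zup k (m - k)%N; rewrite subnKC //; last exact: ltnW.
    lra.
  apply/andP; split.
    apply: ub_le_sup; last by exists n.
    by exists (z n + c * u n) => _ [m _ <-]; exact: zz.
  apply: ge_sup; first by exists (z 0%N), 0%N.
  by move=> _ [m _ <-]; exact: zz.
have [xl xlP] := lim x a a0 (fun n => (stepn n).1).
have [yl ylP] := lim y b b0 (fun n => (stepn n).2).
have inl : X1 <= xl <= X2 /\ Y1 <= yl <= Y2.
  have := xlP 0%N; have := ylP 0%N; have [[]] := badn 0%N; lra.
(* With [eta / 2] the small rectangles have at most half of the circulation that [badn]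
   guarantees. *)
have [d d0 H] := bdint_small (PQ inl.1 inl.2) (divr_gt0 eta0 (ltr0Sn R 1)).
have [n hn] : exists n, (a + b) * u n < d.
  have : u n @[n --> \oo] --> 0.
    by apply: cvg_expr; rewrite ger0_norm ?invr_ge0 //; lra.
  move/cvgrPdist_lt => /(_ (d / (a + b)) (divr_gt0 d0 ab0)) [n _ /(_ n)].
  rewrite /= sub0r normrN gtr0_norm // => /(_ (leqnn n)) h.
  by exists n; rewrite mulrC -ltr_pdivlMr.
have [rn In] := badn n.
have := H _ _ _ _ rn (ltW (au n)) (ltW (bu n)).
rewrite -mulrDl => /(_ hn (xlP n) (ylP n)) h.
have : 0 < eta * ((a + b) * u n) ^+ 2 by rewrite mulr_gt0 // exprn_gt0 // mulr_gt0.
move: In; rewrite -mulrDl => In; have := le_trans In h; lra.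
Qed.

End Goursat.

(** * The maximum modulus principle *)

Section ComplexExponential.
Set Implicit Arguments.
Unset Strict Implicit.
Variable R : realType.
Implicit Types z w : R[i].

Lemma cexpD z w : cexp (z + w) = cexp z * cexp w.
Proof.
case: z w => [a b] [c d]; apply/eqP; rewrite eq_complex /cexp /= expRD cosD sinD.
by apply/andP; split; apply/eqP; ring.
Qed.

Lemma mod_cexp z : N (cexp z) = expR (complex.Re z).
Proof.
case: z => a b; rewrite /cexp modM mod_real /= ger0_norm ?expR_ge0 //.
by rewrite cos2Dsin2 sqrtr1 mulr1.
Qed.

Lemma cexp_2pi (x y : R) : cexp (x +i* (y + pi *+ 2)) = cexp (x +i* y).
Proof. by rewrite /cexp /= cosD2pi sinD2pi. Qed.

Lemma is_derive_eps (f : R -> R) (x l : R) : is_derive x 1 f l ->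
  forall e : R, 0 < e -> exists2 d : R, 0 < d &
    forall h, `|h| < d -> `|f (x + h) - f x - l * h| <= e * `|h|.
Proof.
move=> [fd fl] e e0.
have : h^-1 *: ((f \o shift x) (h *: (1 : R)) - f x) @[h --> 0^'] --> l.
  by rewrite -fl; exact: fd.
move/cvgrPdist_le => /(_ e e0); rewrite near_withinE => /nbhs_ballP[d /= d0 H].
exists d => // h hd; case: (eqVneq h 0) => [->|h0].
  by rewrite addr0 subrr mulr0 subrr normr0 mulr0.
have := H h; rewrite /ball /= sub0r normrN => /(_ hd h0).
rewrite /= /shift /= [h%:A]mulr1 /GRing.scale /= distrC => E.
have -> : f (x + h) - f x - l * h = (h^-1 * (f (h + x) - f x) - l) * h.
  by rewrite mulrBl mulrAC mulVf // mul1r (addrC h).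
by rewrite normrM ler_wpM2r.
Qed.

Lemma cdiff_cexp0 : cdiff (@cexp R) 0 1.
Proof.
apply/cdiff_eps => e e0.
(* The real and imaginary parts of the remainder are each at most 3 t N h, whence e / 6; the cap 1
   keeps [expR x] below 2. *)
have e60 : 0 < Num.min (e / 6) 1 by rewrite lt_min ltr01 andbT; lra.
set t := Num.min (e / 6) 1 in e60.
have t1 : t <= 1 by rewrite ge_min lexx orbT.
have te : t <= e / 6 by rewrite ge_min lexx.
have [d1 d10 H1] := is_derive_eps (is_derive_expR (0 : R)) e60.
have [d2 d20 H2] := is_derive_eps (is_derive_cos (0 : R)) e60.
have [d3 d30 H3] := is_derive_eps (is_derive_sin (0 : R)) e60.
exists (Num.min (Num.min d1 (t / 2)) (Num.min d2 d3)).
  by rewrite !lt_min d10 d20 d30 andbT /=; lra.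
move=> h; rewrite !lt_min => /andP[/andP[hd1 ht] /andP[hd2 hd3]].
have hx := Re_le_mod h; have hy := Im_le_mod h.
set x := complex.Re h in hx; set y := complex.Im h in hy.
have := H1 x (le_lt_trans hx hd1); rewrite add0r expR0 mul1r => {}H1.
have := H2 y (le_lt_trans hy hd2).
rewrite add0r cos0 sin0 oppr0 mul0r subr0 => {}H2.
have := H3 y (le_lt_trans hy hd3).
rewrite add0r sin0 cos0 mul1r subr0 => {}H3.
have Ex : `|expR x - 1| <= 2 * `|x|.
  have -> : expR x - 1 = (expR x - 1 - x) + x by rewrite subrK.
  apply: (le_trans (ler_normD _ _)).
  have : t * `|x| <= 1 * `|x| by rewrite ler_wpM2r.
  lra.
have E2 : `|expR x - 1| <= t by lra.
have E3 : expR x <= 2 by move: E2; rewrite ler_norml; lra.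
apply: (le_trans (mod_le_ReIm _)).
have -> : complex.Re (cexp (0 + h) - cexp 0 - 1 * h) =
   expR x * (cos y - 1) + (expR x - 1 - x).
  rewrite add0r mul1r /x /y; case: h {H1 H2 H3 Ex E2 E3 hx hy hd1 ht hd2 hd3 x y} => a b.
  by rewrite /cexp /= expR0 cos0 sin0; ring.
have -> : complex.Im (cexp (0 + h) - cexp 0 - 1 * h) =
   expR x * (sin y - y) + (expR x - 1) * y.
  rewrite add0r mul1r /x /y; case: h {H1 H2 H3 Ex E2 E3 hx hy hd1 ht hd2 hd3 x y} => a b.
  by rewrite /cexp /= expR0 cos0 sin0; ring.
have I1 : `|expR x * (cos y - 1) + (expR x - 1 - x)| <= 3 * t * N h.
  apply: (le_trans (ler_normD _ _)); rewrite normrM (ger0_norm (expR_ge0 _)).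
  have : expR x * `|cos y - 1| <= 2 * (t * N h).
    apply: ler_pM; rewrite ?expR_ge0 //; apply: (le_trans H2).
    by rewrite ler_wpM2l // ltW.
  have : t * `|x| <= t * N h by rewrite ler_wpM2l // ltW.
  lra.
have I2 : `|expR x * (sin y - y) + (expR x - 1) * y| <= 3 * t * N h.
  apply: (le_trans (ler_normD _ _)); rewrite !normrM (ger0_norm (expR_ge0 _)).
  have : expR x * `|sin y - y| <= 2 * (t * N h).
    apply: ler_pM; rewrite ?expR_ge0 //; apply: (le_trans H3).
    by rewrite ler_wpM2l // ltW.
  have : `|expR x - 1| * `|y| <= t * N h by apply: ler_pM.
  lra.
apply: (le_trans (lerD I1 I2)); rewrite -mulrDl ler_wpM2r ?mod_ge0 //; lra.
Qed.

Lemma cdiff_cexp z : cdiff (@cexp R) z (cexp z).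
Proof.
have -> : cdiff (@cexp R) z =
    cdiff ((fun w => cexp z * w) \o (@cexp R \o (fun w => w - z))) z.
  by congr cdiff; apply/funext => w /=; rewrite -cexpD addrC subrK.
have c1 : cdiff (fun w => w - z) z 1.
  by rewrite -[X in cdiff _ _ X](addr0 1); apply: cdiffD; [exact: cdiff_id|exact: cdiff_cst].
have c2 : cdiff (@cexp R \o (fun w => w - z)) z (1 * 1).
  by apply: (cdiff_comp c1); rewrite subrr; exact: cdiff_cexp0.
have cm w : cdiff (fun w => cexp z * w) w (cexp z).
  have := cdiffM (cdiff_cst (cexp z) w) (cdiff_id w).
  by rewrite mul0r add0r mulr1.
by have := cdiff_comp c2 (cm _); rewrite !mulr1.
Qed.

End ComplexExponential.

Section MaximumModulus.
Set Implicit Arguments.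
Unset Strict Implicit.
Variable R : realType.
Implicit Types (f g h H : R[i] -> R[i]) (z v w : R[i]).

(** The form is the imaginary part of g dz. The Cauchy-Riemann equations make the real part of the
    derivative both dP/dy and dQ/dx. The imaginary part is taken so that vertical sides carry Re
    g. *)
Lemma cdiff_closed_form g l (x0 y0 : R) : cdiff g (x0 +i* y0) l ->
  closed_form_at (fun x y => complex.Im (g (x +i* y)))
                 (fun x y => complex.Re (g (x +i* y))) x0 y0.
Proof.
move=> /cdiff_eps gl.
exists (complex.Im l), (complex.Re l), (- complex.Im l) => e e0.
have [d d0 {}gl] := gl _ e0; exists (d / 2); first lra.
move=> x y xd yd; pose k := (x - x0) +i* (y - y0).
have kE : N k <= `|x - x0| + `|y - y0| by exact: mod_le_ReIm k.
have := gl k ltac:(lra).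
have -> : (x0 +i* y0) + k = x +i* y.
  by apply/eqP; rewrite eq_complex /= !(addrC x0) !(addrC y0) !subrK !eqxx.
set E := _ - _ - _ => Ek.
have {}Ek : N E <= e * (`|x - x0| + `|y - y0|).
  by apply: (le_trans Ek); rewrite ler_pM2l.
split; apply: le_trans Ek.
  apply: le_trans (Im_le_mod _).
  rewrite le_eqVlt; apply/orP; left; apply/eqP; congr (`|_|).
  rewrite /E /k; case: (g _) (g _) l {gl E} => [a b] [c c'] [m n] /=; ring.
apply: le_trans (Re_le_mod _).
rewrite le_eqVlt; apply/orP; left; apply/eqP; congr (`|_|).
rewrite /E /k; case: (g _) (g _) l {gl E} => [a b] [c c'] [m n] /=; ring.
Qed.

(* Goursat's lemma on the rectangle [s, 0] x [0, 2 pi] for [H (cexp w)]: by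
   periodicity the horizontal sides cancel, so that the mean of H over the
   circle of radius [expR s] does not depend on s; then s tends to -oo. *)
Lemma mean_value H :
  H w @[w --> 0] --> H 0 ->
  (forall z, 0 < N z -> N z <= 1 -> exists l, cdiff H z l) ->
  continuous_on 0 (pi *+ 2) (fun t : R => complex.Re (H (cexp (0 +i* t)))) /\
  segint 0 (pi *+ 2) (fun t => complex.Re (H (cexp (0 +i* t)))) =
  complex.Re (H 0) * (pi *+ 2).
Proof.
move=> H0 Hd; pose g w := H (cexp w).
pose P x y := complex.Im (g (x +i* y)); pose Q x y := complex.Re (g (x +i* y)).
have PQ x y : x <= 0 -> closed_form_at P Q x y.
  move=> x0; have [] := Hd (cexp (x +i* y)).
  - by rewrite mod_cexp expR_gt0.
  - by rewrite mod_cexp -expR0 ler_expR.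
  move=> l Hl; apply: (@cdiff_closed_form _ (l * cexp (x +i* y))).
  exact: cdiff_comp (cdiff_cexp _) Hl.
have Qc x : x <= 0 -> continuous_on 0 (pi *+ 2) (Q x).
  by move=> x0 y _; exact: (closed_form_continuous (PQ x y x0)).2.
have pi2 : 0 < pi *+ 2 :> R by rewrite mulrn_wgt0 // pi_gt0.
have Qs s : s < 0 -> segint 0 (pi *+ 2) (Q 0) = segint 0 (pi *+ 2) (Q s).
  move=> s0.
  have : bdint P Q s 0 (0 - s) (pi *+ 2 - 0) = 0.
    by apply: goursat => // x y /andP[_ x0] _; exact: PQ.
  rewrite /bdint !subr0 !add0r addrN.
  have -> : P^~ (pi *+ 2) = P^~ 0.
    by apply/funext => x; rewrite /P /g -[in RHS]cexp_2pi add0r.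
  by rewrite subrr add0r => /eqP; rewrite subr_eq0 => /eqP.
split; first exact: (Qc 0).
apply/eqP; rewrite -subr_eq0 -normr_eq0 eq_le normr_ge0 andbT.
apply/ler_addgt0Pl => e e0; rewrite addr0.
move/cvg_modP: H0 => /(_ _ (divr_gt0 e0 pi2))[d d0 dH].
(* Chosen so that expR (- s) >= 2 + 1/d > 1/d: the circle of radius [expR s] lies in the
   d-neighbourhood of 0. *)
pose s := - (1 + d^-1); have s0 : s < 0.
  by rewrite /s oppr_lt0 addr_gt0 // invr_gt0.
have sd : expR s < d.
  rewrite /s expRN -[ltRHS]invrK ltf_pV2 ?posrE ?invr_gt0 ?expR_gt0 //.
  have := @expR_ge1Dx R (1 + d^-1) ; lra.
rewrite -/(Q 0) (Qs s s0).
have -> : segint 0 (pi *+ 2) (Q s) - complex.Re (H 0) * (pi *+ 2) =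
   segint 0 (pi *+ 2) (fun t => Q s t - complex.Re (H 0)).
  rewrite segintB; [|exact: (Qc s (ltW s0))|exact: continuous_on_cst].
  by rewrite segint_cst ?subr0 // ltW.
have -> : e = e / (pi *+ 2) * (pi *+ 2 - 0).
  by rewrite subr0 divfK // lt0r_neq0.
apply: segint_norm_le; first exact: ltW.
  move=> t ht; apply: continuousB; first exact: (Qc s (ltW s0)).
  exact: cst_continuous.
move=> t _; rewrite /Q.
have := dH (cexp (s +i* t)); rewrite subr0 mod_cexp /= => /(_ sd) h.
rewrite -raddfB; apply: (le_trans (Re_le_mod _)); exact: ltW.
Qed.

Lemma mod_le_Re z : N z <= complex.Re z -> z = (N z)%:C.
Proof.
move=> zr; have : N z ^+ 2 <= complex.Re z ^+ 2.
  by rewrite ler_pXn2r ?nnegrE ?mod_ge0 // (le_trans (mod_ge0 z)).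
rewrite sqr_modE gerDl => /(conj (sqr_ge0 (complex.Im z)))/andP/le_anti /esym/eqP.
rewrite sqrf_eq0 => /eqP zi.
apply/eqP; rewrite eq_complex zi /= eqxx andbT.
by rewrite eq_le zr andbT (le_trans _ (Re_le_mod _)) // ler_norm.
Qed.

(* Evaluation at the interior point t = pi of the interval of integration. *)
Lemma maximum_modulus h z0 v :
  h w @[w --> z0] --> h z0 ->
  (forall z, z != z0 -> N (z - z0) <= N v -> exists l, cdiff h z l) ->
  (forall z, N (z - z0) <= N v -> N (h z) <= N (h z0)) ->
  h (z0 - v) = h z0.
Proof.
move=> hc hd hm.
have [->|v0] := eqVneq v 0; first by rewrite subr0.
set M := N (h z0).
have [hz0|hz0] := eqVneq (h z0) 0.
  have := hm (z0 - v); rewrite addrAC subrr add0r modN => /(_ (lexx _)).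
  rewrite hz0 mod0 => h0; apply/eqP.
  by rewrite -mod_eq0 eq_le h0 mod_ge0.
(* The factor conj (h z0) makes H 0 equal to M^2, a real number that also bounds |H|. The mean of Re
   H then attains its upper bound, which forces Re H = M^2 at the chosen point. *)
pose H w := (h z0)^# * h (z0 + v * w).
have dv w : cdiff (fun w => z0 + v * w) w v.
  have := cdiffD (cdiff_cst z0 w) (cdiffM (cdiff_cst v w) (cdiff_id w)).
  by rewrite mul0r !add0r mulr1.
have [| |Hc HI] := @mean_value H.
- rewrite /H mulr0 addr0; apply: (cvgMC (@cvg_cstC _ _ _)).
  apply/cvg_modP => e e0; move/cvg_modP: hc => /(_ _ e0)[d d0 dH].
  exists (d / N v); first by rewrite divr_gt0 // mod_gt0.
  move=> w; rewrite subr0 => wd; apply: dH.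
  by rewrite addrAC subrr add0r modM mulrC -ltr_pdivlMr // mod_gt0.
- move=> z zgt0 z1; have [] := hd (z0 + v * z).
  + rewrite -subr_eq0 addrAC subrr add0r mulf_neq0 //.
    by rewrite -mod_gt0.
  + by rewrite addrAC subrr add0r modM -[leRHS]mulr1 ler_wpM2l ?mod_ge0.
  move=> l hl.
  have := cdiffM (cdiff_cst (h z0)^# z) (cdiff_comp (dv z) hl).
  by eexists; eassumption.
have HM z : N z <= 1 -> N (H z) <= M ^+ 2.
  move=> z1; rewrite /H modM modJ expr2 ler_wpM2l ?mod_ge0 //; apply: hm.
  by rewrite addrAC subrr add0r modM -[leRHS]mulr1 ler_wpM2l ?mod_ge0.
have H0 : H 0 = (M ^+ 2)%:C by rewrite /H mulr0 addr0 mulrC mulJ.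
have He t : N (cexp (0 +i* t)) = 1 by rewrite mod_cexp /= expR0.
have Hpi : M ^+ 2 - complex.Re (H (cexp (0 +i* pi))) = 0.
  apply: (@segint_ge0_eq0 R 0 (pi *+ 2)
    (fun t => M ^+ 2 - complex.Re (H (cexp (0 +i* t))))).
  - by have := pi_gt0 R; rewrite mulr2n; lra.
  - move=> t ht; apply: continuousB; first exact: cst_continuous.
    exact: Hc.
  - move=> t _; rewrite subr_ge0.
    have := HM (cexp (0 +i* t)); rewrite He lexx => /(_ isT).
    by apply: le_trans; exact: le_trans (ler_norm _) (Re_le_mod _).
  - rewrite segintB //; last exact: continuous_on_cst.
    rewrite segint_cst ?HI ?H0 /= ?subr0 ?subrr //.
    by rewrite mulrn_wge0 // pi_ge0.
have cpi : cexp (0 +i* pi) = -1 :> R[i].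
  rewrite /cexp /= expR0 cospi sinpi mul1r.
  by apply/eqP; rewrite eq_complex /= oppr0 !eqxx.
(* A number of modulus at most M^2 with real part M^2 has no imaginary part, so equality of real
   parts becomes equality. *)
have Hm1 : H (-1) = (M ^+ 2)%:C.
  have N1 : N (-1 : R[i]) <= 1 by rewrite modN mod1.
  have ReM : complex.Re (H (-1)) = M ^+ 2.
    by move/eqP: Hpi; rewrite cpi subr_eq0 => /eqP.
  rewrite (@mod_le_Re (H (-1))) ?ReM ?HM //.
  congr (_%:C); apply/eqP; rewrite eq_le HM //= -{1}ReM.
  exact: le_trans (ler_norm _) (Re_le_mod _).
move: Hm1; rewrite -H0 /H mulr0 addr0 mulrN1.
by apply: mulfI; rewrite conjc_eq0.
Qed.

Lemma continuous_pair (F : R[i] -> R) (p : R * R) :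
  (forall e, 0 < e -> exists2 d, 0 < d &
     forall w, N (w - (p.1 +i* p.2)) < d -> `|F w - F (p.1 +i* p.2)| < e) ->
  {for p, continuous (fun p : R * R => F (p.1 +i* p.2))}.
Proof.
move=> FP; apply/cvgrPdist_lt => e e0; have [d d0 H] := FP _ e0.
have d20 : 0 < d / 2 by lra.
exists (ball p.1 (d / 2), ball p.2 (d / 2)) => /=.
  by split; exact: nbhsx_ballx.
move=> q [/= q1 q2]; rewrite distrC; apply: H.
apply: (le_lt_trans (mod_le_ReIm _)) => /=.
by move: q1 q2; rewrite /ball /= !(distrC (fst p)) !(distrC (snd p)); lra.
Qed.

(** The closed disc is read in R * R, as a closed subset of a product of segments, and the extreme
    value theorem is applied there. *)
Lemma max_on_closed_disc h (r : R) : 0 <= r ->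
  (forall z, N z <= r -> h w @[w --> z] --> h z) ->
  exists2 z0, N z0 <= r & forall z, N z <= r -> N (h z) <= N (h z0).
Proof.
move=> r0 hc.
pose K := [set p : R * R | N (p.1 +i* p.2) <= r].
pose F (p : R * R) := N (h (p.1 +i* p.2)).
have Kc : compact K.
  apply: (@subclosed_compact _ _ (`[- r, r] `*` `[- r, r])).
  - rewrite (_ : K = (fun p : R * R => N (p.1 +i* p.2)) @^-1` [set x | x <= r]) //.
    apply: closed_comp; last exact: closed_le.
    move=> p _; apply: (@continuous_pair (fun z => N z)) => e e0.
    exists e => // w we.
    apply: le_lt_trans we; rewrite ler_norml -lerBlDr opprK.
    have := mod_dist w (p.1 +i* p.2); have := mod_dist (p.1 +i* p.2) w.
    by rewrite modB; set a := N _; set b := N w; set c := N _; lra.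
  - by apply: compact_setX; exact: segment_compact.
  - move=> p; rewrite /K /= !in_itv /= -!ler_norml => pr; split.
      by apply: le_trans pr; exact: (Re_le_mod (p.1 +i* p.2)).
    by apply: le_trans pr; exact: (Im_le_mod (p.1 +i* p.2)).
have K0 : K !=set0 by exists (0, 0); rewrite /K /= expr0n addr0 sqrtr0.
have Fc : {within K, continuous F}.
  apply: continuous_in_subspaceT => p; rewrite inE => pK.
  apply: (@continuous_pair (fun z => N (h z))) => e e0.
  have /cvg_modP/(_ _ e0)[d d0 H] := hc _ pK; exists d => // w /H.
  apply: le_lt_trans; rewrite ler_norml.
  have := mod_dist (h w) (h (p.1 +i* p.2)).
  have := mod_dist (h (p.1 +i* p.2)) (h w).
  by rewrite modB; set a := N _; set b := N _; set c := N _; lra.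
have [p pK pmax] := compact_EVT_max K0 Kc Fc.
exists (p.1 +i* p.2); first by rewrite inE in pK.
move=> [x y] zr; apply: (pmax (x, y)).
by rewrite inE.
Qed.

End MaximumModulus.

(** * Schwarz's lemma and the automorphisms of the disc *)

Section Schwarz.
Set Implicit Arguments.
Unset Strict Implicit.
Variable R : realType.
Implicit Types (f : R[i] -> R[i]) (z w : R[i]).

Definition cholomorphic_disc f := forall z, N z < 1 -> exists l, cdiff f z l.

(** The Caratheodory quotient at 0 serves as f z / z. It comes with continuity but no derivative at
    0, which is why [mean_value] and [maximum_modulus] ask for continuity alone at the centre. *)
Lemma origin_quotient f : cholomorphic_disc f -> f 0 = 0 ->
  exists q : R[i] -> R[i],
  [/\ forall w, f w = q w * w,
      forall z, N z < 1 -> q w @[w --> z] --> q z &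
      forall z, z != 0 -> N z < 1 -> exists l, cdiff q z l].
Proof.
move=> fd f0; have [l [q [fq q0 ql]]] := fd 0 ltac:(by rewrite mod0).
have {}fq w : f w = q w * w by move: (fq w); rewrite f0 !subr0.
have qd z : z != 0 -> N z < 1 -> exists l, cdiff q z l.
  move=> z0 z1; have [m fm] := fd z z1.
  have := cdiffM fm (cdiffV z0 (cdiff_id z)) => fw.
  eexists; apply: (cdiff_local (r := N z) _ _ fw); first by rewrite mod_gt0.
  move=> w wz; rewrite fq mulfK //; apply/eqP => w0.
  by move: wz; rewrite w0 sub0r modN ltxx.
exists q; split; [exact: fq| |exact: qd].
move=> z z1; have [->|z0] := eqVneq z 0; first by rewrite q0; exact: ql.
by have [m] := qd z z0 z1; exact: cdiff_continuous.
Qed.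

(* A maximum of |q| exceeding 1 would be attained: moving away from the origin
   by a fixed step keeps the value of q, until a region is reached where
   |q| is too small. *)
Lemma schwarz f : cholomorphic_disc f -> f 0 = 0 ->
  (forall z, N z < 1 -> N (f z) < 1) -> forall z, N z < 1 -> N (f z) <= N z.
Proof.
move=> fd f0 f1 z1 z11; rewrite leNgt; apply/negP => fz1.
have [q [fq qc qd]] := origin_quotient fd f0.
have z10 : 0 < N z1.
  by rewrite mod_gt0; apply/eqP => z10; move: fz1; rewrite z10 f0 ltxx.
have q1 : 1 < N (q z1).
  by move: fz1; rewrite fq modM -{1}(mul1r (N z1)) ltr_pM2r.
(* Beyond radius r, |q z| < 1 / |z| < |q z1|, since f maps the disc into itself; a maximum over the
   disc of radius r is thus a maximum over the whole disc. *)
pose r := Num.max (N z1) (N (q z1))^-1.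
have r1 : r < 1 by rewrite gt_max z11 invf_lt1 // (lt_trans ltr01).
have zr : N z1 <= r by rewrite le_max lexx.
have r0 : 0 < r by exact: lt_le_trans zr.
have [z0 z0r qmax] := max_on_closed_disc (ltW r0) (fun z zr => qc z (le_lt_trans zr r1)).
have M1 : N (q z1) <= N (q z0) by exact: qmax.
have far z : r < N z -> N z < 1 -> N (q z) < N (q z0).
  move=> rz z1'; apply: lt_le_trans M1.
  have Nz0 : 0 < N z by exact: lt_trans rz.
  have := f1 z z1'; rewrite fq modM -ltr_pdivlMr // mul1r => h.
  apply: (lt_trans h); rewrite -[ltRHS]invrK ltf_pV2 ?posrE ?invr_gt0 //.
    by apply: le_lt_trans rz; rewrite le_max lexx orbT.
  exact: lt_trans q1.
have glob z : N z < 1 -> N (q z) <= N (q z0).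
  by move=> zl; case: (leP (N z) r) => [/qmax//|rz]; exact/ltW/far.
have step z v : N (q z) = N (q z0) -> N z + N v < 1 ->
    (z = 0 \/ N v < N z) -> q (z - v) = q z.
  move=> Ez zv hz.
  have in1 w : N (w - z) <= N v -> N w < 1.
    move=> wz; apply: le_lt_trans zv; rewrite -(subrK z w) addrC.
    by apply: (le_trans (modD _ _)); rewrite lerD2l.
  apply: maximum_modulus.
  - by apply: qc; apply: in1; rewrite subrr mod0 mod_ge0.
  - move=> w wz wv; apply: qd; last exact: in1.
    case: hz => [z0E|hz]; first by rewrite z0E in wz.
    apply/eqP => w0; move: wv; rewrite w0 sub0r modN; lra.
  - by move=> w /in1; rewrite Ez; exact: glob.
have NRe (x : R) : 0 <= x -> N x%:C = x by move=> x0; rewrite mod_real ger0_norm.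
(* From the origin a single step of length (1 + r) / 2 already reaches the region where |q| is too
   small. *)
have [z00|z00] := eqVneq z0 0.
  have e0 : 0 <= (1 + r) / 2 by lra.
  have Nv := NRe _ e0.
  have := step z0 ((1 + r) / 2)%:C erefl.
  rewrite Nv z00 mod0 => /(_ ltac:(lra) ltac:(by left)) E.
  have := far (0 - ((1 + r) / 2)%:C); rewrite sub0r modN Nv.
  rewrite sub0r in E.
  by rewrite E z00 => /(_ ltac:(lra) ltac:(lra)); rewrite ltxx.
(* A circle of radius d around any point of modulus between |z0| and r avoids the origin and stays
   in the disc. Each step is radial and outward, so the modulus grows by exactly d. *)
pose d := Num.min (N z0) (1 - r) / 2.
have Nz0 : 0 < N z0 by rewrite mod_gt0.
have mn : 0 < Num.min (N z0) (1 - r) by rewrite lt_min Nz0; lra.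
have mz : Num.min (N z0) (1 - r) <= N z0 by rewrite ge_min lexx.
have mr : Num.min (N z0) (1 - r) <= 1 - r by rewrite ge_min lexx orbT.
have walk n : exists2 z, N z0 + n%:R * d <= N z & N z < 1 /\ N (q z) = N (q z0).
  elim: n => [|n [z zn [zl zq]]].
    by exists z0; rewrite ?mul0r ?addr0 //; split=> //; lra.
  have zr' : N z <= r.
    by rewrite leNgt; apply/negP => rz; have := far z rz zl; rewrite zq ltxx.
  have nd : 0 <= n%:R * d by rewrite mulr_ge0 // /d; lra.
  have Nz : 0 < N z by lra.
  pose v := - (z * (d / N z)%:C).
  have Nv : N v = d.
    by rewrite /v modN modM NRe ?divr_ge0 // 1?mulrC ?divfK ?lt0r_neq0 // /d; lra.
  have E := step z v zq; rewrite Nv in E.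
  have {}E := E ltac:(rewrite /d; lra) ltac:(right; rewrite /d; lra).
  have zv : N (z - v) = N z + d.
    rewrite /v opprK -{1}(mulr1 z) -mulrDr modM -(rmorph1 (real_complex R)) -rmorphD NRe.
      by rewrite mulrDr mulr1 (mulrC (N z) (d / _)) divfK ?lt0r_neq0.
    by rewrite addr_ge0 // divr_ge0 // /d; lra.
  exists (z - v); first by rewrite zv -natr1 mulrDl mul1r; lra.
  by rewrite zv E; split=> //; rewrite /d; lra.
have d0 : 0 < d by rewrite /d; lra.
(* After more than 1 / d steps the modulus would exceed 1. *)
have [z zn [zl _]] := walk (Num.truncn d^-1).+1.
have : d^-1 < (Num.truncn d^-1).+1%:R by apply: truncnS_gt.
rewrite -(@ltr_pM2r _ d) // mulVf ?lt0r_neq0 //; lra.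
Qed.

(** The quotient q = f z / z has modulus 1 off the origin, hence at the origin by continuity. So |q|
    is maximal at 0, and the maximum principle on each circle around 0 makes q constant. *)
Lemma schwarz_rotation f : cholomorphic_disc f -> f 0 = 0 ->
  (forall z, N z < 1 -> N (f z) = N z) ->
  exists2 e : R[i], N e = 1 & forall z, N z < 1 -> f z = e * z.
Proof.
move=> fd f0 f1; have [q [fq qc qd]] := origin_quotient fd f0.
have q1 z : z != 0 -> N z < 1 -> N (q z) = 1.
  move=> z0 z1; have := f1 z z1; rewrite fq modM -[RHS]mul1r.
  by apply: mulIf; rewrite mod_eq0.
have hE z : N z < 1 -> N (q 0) >= 1 -> q z = q 0.
  move=> z1 q0; have := @maximum_modulus R q 0 (- z).
  rewrite sub0r opprK modN; apply.
  - by apply: qc; rewrite mod0.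
  - by move=> w w0; rewrite subr0 => wz; apply: qd => //; exact: le_lt_trans z1.
  - move=> w; rewrite subr0 => wz; have [->//|w0] := eqVneq w 0.
    by rewrite q1 // (le_lt_trans wz).
have q0 : 1 <= N (q 0).
  rewrite leNgt; apply/negP => q01.
  have /cvg_modP := qc 0 ltac:(by rewrite mod0).
  move=> /(_ (1 - N (q 0)))[]; first by lra.
  move=> d d0 H; pose t := Num.min d 1 / 2.
  have m0 : 0 < Num.min d 1 by rewrite lt_min d0 /=.
  have md : Num.min d 1 <= d by rewrite ge_min lexx.
  have m1 : Num.min d 1 <= 1 by rewrite ge_min lexx orbT.
  have Nt : N t%:C = t by rewrite mod_real ger0_norm // /t; lra.
  have := H t%:C; rewrite subr0 Nt => /(_ ltac:(rewrite /t; lra)) qt.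
  have := q1 t%:C; rewrite -mod_gt0 Nt.
  move=> /(_ ltac:(rewrite /t; lra) ltac:(rewrite /t; lra)).
  have := mod_dist (q t%:C) (q 0); lra.
have half : N ((1 / 2)%:C : R[i]) = 1 / 2 by rewrite mod_real ger0_norm //; lra.
exists (q 0); last by move=> z z1; rewrite fq hE.
rewrite -(@hE (1 / 2)%:C) // ?half; last lra.
by apply: q1; rewrite -?mod_gt0 half; lra.
Qed.

End Schwarz.

Section Moebius.
Set Implicit Arguments.
Unset Strict Implicit.
Variable R : realType.
Implicit Types (e b z w : R[i]).

Definition moebius e b z := e * (z - b) / (1 - b^# * z).

Lemma moebius_den_neq0 b z : N b < 1 -> N z <= 1 -> 1 - b^# * z != 0.
Proof.
move=> b1 z1; rewrite -mod_gt0; have := mod_dist 1 (b^# * z).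
rewrite mod1 modM modJ.
have : N b * N z <= N b * 1 by rewrite ler_wpM2l ?mod_ge0.
lra.
Qed.

Lemma sqr_mod_moebius_den b z :
  N (1 - b^# * z) ^+ 2 - N (z - b) ^+ 2 = (1 - N b ^+ 2) * (1 - N z ^+ 2).
Proof. by rewrite !sqr_modE; case: b z => [b1 b2] [z1 z2] /=; ring. Qed.

Lemma moebius_mod e b z : N e = 1 -> N b < 1 -> N z <= 1 ->
  1 - N (moebius e b z) ^+ 2 =
  (1 - N b ^+ 2) * (1 - N z ^+ 2) / N (1 - b^# * z) ^+ 2.
Proof.
move=> e1 b1 z1; have d0 : N (1 - b^# * z) ^+ 2 != 0.
  by rewrite expf_neq0 // mod_eq0 moebius_den_neq0.
rewrite /moebius !modM modV e1 mul1r expr_div_n -sqr_mod_moebius_den.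
by rewrite mulrBl divff.
Qed.

Lemma subr_sqr_mod_gt0 b : N b < 1 -> 0 < 1 - N b ^+ 2.
Proof. by move=> b1; rewrite subr_gt0 expr_lt1 ?mod_ge0. Qed.

Lemma moebius_disc e b z : N e = 1 -> N b < 1 -> N z < 1 ->
  N (moebius e b z) < 1.
Proof.
move=> e1 b1 z1; rewrite -(@expr_lt1 _ 2) ?mod_ge0 // -subr_gt0.
rewrite moebius_mod ?(ltW z1) //.
apply: divr_gt0; first by apply: mulr_gt0; exact: subr_sqr_mod_gt0.
by rewrite exprn_gt0 // mod_gt0 moebius_den_neq0 // ltW.
Qed.

Lemma moebius_circle e b z : N e = 1 -> N b < 1 -> N z = 1 ->
  N (moebius e b z) = 1.
Proof.
move=> e1 b1 z1; have := moebius_mod e1 b1 (mod_le1 z1).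
rewrite z1 expr1n subrr mulr0 mul0r => /eqP; rewrite subr_eq0 eq_sym.
by rewrite sqrp_eq1 ?mod_ge0 // => /eqP.
Qed.

Lemma moebiusB e b z w : N b < 1 -> N z <= 1 -> N w <= 1 ->
  moebius e b z - moebius e b w =
  e * (1 - b * b^#) * (z - w) / ((1 - b^# * z) * (1 - b^# * w)).
Proof.
move=> b1 z1 w1; rewrite /moebius.
by field; rewrite !moebius_den_neq0.
Qed.

Lemma cdiff_moebius e b z : N b < 1 -> N z <= 1 ->
  cdiff (moebius e b) z (e * (1 - b * b^#) / (1 - b^# * z) ^+ 2).
Proof.
move=> b1 z1; have d0 := moebius_den_neq0 b1 z1.
have c1 : cdiff (fun w => e * (w + - b)) z (0 * (z + - b) + e * (1 + 0)).
  exact: (cdiffM (cdiff_cst e z) (cdiffD (cdiff_id z) (cdiff_cst (- b) z))).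
have c2 : cdiff (fun w => 1 + (- b^#) * w) z (0 + (0 * z + - b^# * 1)).
  exact: (cdiffD (cdiff_cst 1 z) (cdiffM (cdiff_cst (- b^#) z) (cdiff_id z))).
have d0' : 1 + (- b^#) * z != 0 by rewrite mulNr.
have := cdiffM c1 (@cdiffV _ (fun w => 1 + - b^# * w) _ _ d0' c2).
have -> : (fun w => e * (w + - b) * (1 + - b^# * w)^-1) = moebius e b.
  by apply/funext => w; rewrite /moebius mulNr.
congr cdiff; rewrite mulNr; field; exact: d0.
Qed.

Lemma moebiusK b z : N b < 1 -> N z < 1 -> moebius 1 (- b) (moebius 1 b z) = z.
Proof.
move=> b1 z1; have d0 := moebius_den_neq0 b1 (ltW z1).
have d1 : 1 - b * b^# != 0.
  rewrite mulJ -(rmorph1 (real_complex R)) -rmorphB -mod_gt0 mod_real.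
  by rewrite normr_gt0 lt0r_neq0 // subr_sqr_mod_gt0.
rewrite /moebius rmorphN /= !mul1r mulNr !opprK.
have -> : (z - b) / (1 - b^# * z) + b = (1 - b * b^#) * z / (1 - b^# * z) by field.
have -> : 1 + b^# * ((z - b) / (1 - b^# * z)) = (1 - b * b^#) / (1 - b^# * z) by field.
by field; rewrite d0 d1.
Qed.

(** Composing [phi] with the Moebius map that sends phi 0 to 0 gives a map f fixing 0. Schwarz's
    lemma for f and for its inverse g gives |f z| = |z|, so f is a rotation. *)
Lemma disc_automorphism_moebius_disc (phi : R[i] -> R[i]) :
  disc_automorphism phi -> exists e b, [/\ N e = 1, N b < 1 &
    forall z, N z < 1 -> phi z = moebius e b z].
Proof.
move=> [[phi_fun phi_inj phi_surj] phi_hol inv_hol _].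
have phi1 z : N z < 1 -> N (phi z) < 1.
  by move=> /discE /phi_fun /discE.
have inv1 z : N z < 1 -> N (pinv disc phi z) < 1 /\ phi (pinv disc phi z) = z.
  move=> /discE z1; have := phi_surj z z1 => -[w wd wz].
  have zi : z \in [set phi x | x in disc] by rewrite inE; exists w.
  split; last exact: pinvK.
  apply/discE; have := @pinvKV _ _ (fun=> point) _ _ phi_inj w ltac:(by rewrite inE).
  by rewrite wz => ->.
have invK z : N z < 1 -> pinv disc phi (phi z) = z.
  by move=> /discE zd; apply: (pinvKV _ phi_inj); rewrite inE.
pose b := phi 0; have b1 : N b < 1 by apply: phi1; rewrite mod0.
have Nb1 : N (- b) < 1 by rewrite modN.
have N1 : N (1 : R[i]) = 1 by exact: mod1.
pose f := moebius 1 b \o phi; pose g := pinv disc phi \o moebius 1 (- b).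
have fd : cholomorphic_disc f.
  move=> z z1; have pz := derivable_cdiff (phi_hol z ltac:(by apply/discE)).
  have mz := cdiff_moebius 1 b1 (ltW (phi1 z z1)).
  by have := cdiff_comp pz mz; eexists; eassumption.
have gd : cholomorphic_disc g.
  move=> z z1; have mz := cdiff_moebius 1 Nb1 (ltW z1).
  have md := moebius_disc N1 Nb1 z1.
  have pz := derivable_cdiff (inv_hol (moebius 1 (- b) z) ltac:(by apply/discE)).
  by have := cdiff_comp mz pz; eexists; eassumption.
have f0 : f 0 = 0 by rewrite /f /= -/b /moebius subrr mulr0 mul0r.
have g0 : g 0 = 0.
  have := invK 0; rewrite mod0 => /(_ ltac:(lra)); rewrite -/b.
  by rewrite /g /= /moebius sub0r opprK mul1r mulr0 subr0 divr1.
have f1 z : N z < 1 -> N (f z) < 1.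
  by move=> /phi1; exact: moebius_disc.
have g1 z : N z < 1 -> N (g z) < 1.
  by move=> /(moebius_disc N1 Nb1) /inv1[].
have fN z : N z < 1 -> N (f z) = N z.
  move=> z1; apply/eqP; rewrite eq_le (schwarz fd f0 f1 z1) /=.
  have := schwarz gd g0 g1 (f1 z z1).
  by rewrite {1}/g /f /= moebiusK ?invK // phi1.
have [e e1 fe] := schwarz_rotation fd f0 fN.
have ee : e * e^# = 1 by rewrite mulJ e1 expr1n.
(* Solving M_b (phi z) = e z gives phi z = (e z + b) / (1 + conj b e z); factoring e out of the
   numerator gives this zero. *)
exists e, (- b * e^#); split=> //.
  by rewrite modM modN modJ e1 mulr1.
move=> z z1; have := moebiusK b1 (phi1 z z1).
rewrite -[moebius 1 b (phi z)]/(f z) fe // => <-.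
rewrite /moebius mul1r; congr (_ / _).
  by rewrite mulNr !opprK mulrDr mulrCA ee mulr1.
rewrite mulrA; congr (1 - _ * _).
by rewrite [RHS]rmorphM; congr (_ * _); exact/esym/conjcK.
Qed.

Lemma circle_radial (t : R[i]) : N t = 1 -> forall d : R, 0 < d ->
  exists h, [/\ h != 0, N h < d & N (t + h) < 1].
Proof.
move=> t1 d d0; pose s := Num.min d 1 / 2.
have m0 : 0 < Num.min d 1 by rewrite lt_min d0 /=.
have md : Num.min d 1 <= d by rewrite ge_min lexx.
have m1 : Num.min d 1 <= 1 by rewrite ge_min lexx orbT.
have Ns : N (- s%:C * t) = s.
  by rewrite modM modN mod_real t1 mulr1 ger0_norm // /s; lra.
exists (- s%:C * t); rewrite -mod_gt0 Ns; split; [rewrite /s; lra|rewrite /s; lra|].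
rewrite -{1}(mul1r t) -mulrDl modM t1 mulr1 -(rmorph1 (real_complex R)) -rmorphB.
by rewrite mod_real ger0_norm /s; lra.
Qed.

(** At a circle point the value and the derivative of the analytic extension are both recovered from
    inside: the value by continuity, the derivative by [cdiff_accumulation]. *)
Lemma disc_automorphism_moebius (phi : R[i] -> R[i]) :
  disc_automorphism phi -> exists e b, [/\ N e = 1, N b < 1,
    forall z, N z <= 1 -> phi z = moebius e b z &
    forall z, N z = 1 -> derive1 phi z = e * (1 - b * b^#) / (1 - b^# * z) ^+ 2].
Proof.
move=> phi_aut; have [e [b [e1 b1 phiE]]] := disc_automorphism_moebius_disc phi_aut.
have [_ _ _ [U [_ UD Uhol]]] := phi_aut.
have phid z : N z <= 1 -> cdiff phi z (derive1 phi z).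
  by move=> z1; apply/derivable_cdiff/Uhol/UD/closed_discE.
have phiE' z : N z <= 1 -> phi z = moebius e b z.
  rewrite le_eqVlt => /predU1P[z1|]; last exact: phiE.
  have /cdiff_continuous/cvg_modP pc := phid z (mod_le1 z1).
  have /cdiff_continuous/cvg_modP mc := cdiff_moebius e b1 (mod_le1 z1).
  apply/eqP; rewrite -subr_eq0 -mod_eq0 eq_le mod_ge0 andbT.
  apply/ler_addgt0Pl => r r0; rewrite addr0.
  have r20 : 0 < r / 2 by lra.
  have [d1 d10 {}pc] := pc _ r20; have [d2 d20 {}mc] := mc _ r20.
  have [h [_]] := @circle_radial z z1 (Num.min d1 d2) ltac:(by rewrite lt_min d10).
  rewrite lt_min => /andP[hd1 hd2] zh1.
  have zh : z + h - z = h by rewrite addrAC subrr add0r.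
  have := pc (z + h); have := mc (z + h).
  rewrite zh (phiE _ zh1) => /(_ hd2) A /(_ hd1) B.
  rewrite -(subrKA (moebius e b (z + h))).
  by apply: (le_trans (modD _ _)); rewrite (modB (phi z)); lra.
exists e, b; split=> // z z1.
apply: (cdiff_accumulation (phiE' z (mod_le1 z1)) _ (phid z (mod_le1 z1))
  (cdiff_moebius e b1 (mod_le1 z1))) => d d0.
have [h [h0 hd zh]] := circle_radial z1 d0.
by exists h; split=> //; exact: phiE.
Qed.

End Moebius.

(** * Two-sided sequences: telescoping sums and affine recursions *)

Section IntegerSequences.
Set Implicit Arguments.
Unset Strict Implicit.
Variable R : realType.
Implicit Types (y c d G : int -> R) (n : int).

Lemma int_shift_ind (P : int -> Prop) :
  P 0 -> (forall n, P n <-> P (n + 1)) -> forall n, P n.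
Proof.
move=> P0 PS; elim/int_rect => [|n IH|n IH]; first exact: P0.
  by rewrite -addn1 PoszD; exact: (iffLR (PS _)).
by apply: (iffRL (PS _)); rewrite -addn1 PoszD opprD subrK.
Qed.

Lemma increasing_shift_lt y : (forall n, y n < y (n + 1)) ->
  forall m n, m < n -> y m < y n.
Proof.
move=> yS m n mn; rewrite -(subrK m n) addrC.
have : 0 < n - m by rewrite subr_gt0.
case: (n - m) => [[|k]|k] // _; elim: k => [|k IH]; first exact: yS.
by apply: (lt_trans IH); rewrite -[k.+2]addn1 PoszD addrA.
Qed.

(** Each half of the integers telescopes to a difference of two values of G, so that its partial
    sums stay below 2 B. *)
Lemma esum_int_telescope c G (B : R) :
  (forall n, 0 <= c n <= G (n + 1) - G n) -> (forall n, `|G n| <= B) ->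
  (\esum_(n in [set: int]) (c n)%:E < +oo)%E.
Proof.
move=> cG GB.
have c0 n : (0 <= (c n)%:E)%E by rewrite lee_fin; case/andP: (cG n).
have bounded (a : nat -> R) : (forall i, 0 <= a i) ->
    (forall N, \sum_(0 <= i < N) a i <= 2 * B) ->
    (\esum_(i in [set: nat]) (a i)%:E < +oo)%E.
  move=> a0 aB; rewrite -nneseries_esumT; last by move=> i; rewrite lee_fin.
  apply: (@le_lt_trans _ _ (2 * B)%:E); last exact: ltry.
  apply: lime_le; first by apply: is_cvg_nneseries => i _ _; rewrite lee_fin.
  by apply: nearW => N; rewrite sumEFin lee_fin.
rewrite (esumID (range Posz)) // !setTI; apply: lte_add_pinfty.
  rewrite esum_image; last by move=> i j _ _ [].
  apply: bounded => [i|N]; first by case/andP: (cG i).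
  apply: (@le_trans _ _ (G N - G 0)).
    elim: N => [|N IH]; first by rewrite big_nil subrr.
    rewrite big_nat_recr //=; have /andP[_] := cG N.
    have -> : N%:Z + 1 = N.+1 by rewrite -addn1 PoszD.
    lra.
  by have := GB N; have := GB 0; rewrite !ler_norml; lra.
have -> : ~` range Posz = range Negz.
  apply/seteqP; split=> [[k|k]|_ [k _ <-] [j _]] //=; last by exists k.
  by move=> h; exfalso; apply: h; exists k.
rewrite esum_image; last by move=> i j _ _ [].
apply: bounded => [i|N]; first by case/andP: (cG (Negz i)).
apply: (@le_trans _ _ (G 0 - G (- N%:Z))).
  elim: N => [|N IH]; first by rewrite big_nil oppr0 subrr.
  rewrite big_nat_recr //=; have /andP[_] := cG (Negz N).
  have -> : Negz N + 1 = - N%:Z by rewrite NegzE -addn1 PoszD opprD subrK.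
  rewrite -NegzE; lra.
by have := GB (- N%:Z); have := GB 0; rewrite !ler_norml; lra.
Qed.

(** The two product formulas are one recursion unrolled in both directions; backwards it reads c (-
    n) = c (- n + 1) / d (- n), so the divisors start at index -1. *)
Lemma shift_recursion c d : (forall n, 0 < d n) ->
  (forall n, c (n + 1) = d n * c n) <->
  (forall n : nat, (1 <= n)%N -> c n%:Z = c 0 * \prod_(0 <= k < n) d k%:Z) /\
  (forall n : nat, (1 <= n)%N ->
     c (- n%:Z) = c 0 / \prod_(1 <= k < n.+1) d (- k%:Z)).
Proof.
move=> d0.
have P0 (n : nat) : \prod_(1 <= k < n.+1) d (- k%:Z) != 0.
  by rewrite prodf_seq_neq0; apply/allP => k _; rewrite lt0r_neq0 ?implybT.
have SE (n : nat) : n%:Z + 1 = n.+1 by rewrite -addn1 PoszD.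
have NE (n : nat) : - n.+1%:Z + 1 = - n%:Z by rewrite -addn1 PoszD opprD subrK.
split=> [H|[Hp Hn]].
  split; case=> // n _.
    elim: n => [|n IH]; first by rewrite big_nat1 -[1%N]/(0 + 1)%N PoszD H mulrC.
    by rewrite big_nat_recr //= mulrA -IH -SE H mulrC.
  elim: n => [|n IH].
    rewrite big_nat1; have := H (- 1); rewrite addNr => ->.
    by rewrite mulrAC divff ?mul1r // lt0r_neq0.
  rewrite big_nat_recr //= invfM mulrA -IH; have := H (- n.+2%:Z).
  by rewrite NE => ->; rewrite mulrAC divff ?mul1r // lt0r_neq0.
case=> [n|n].
  rewrite SE Hp // big_nat_recr //=.
  case: n => [|n]; first by rewrite big_nil mul1r mulrC.
  by rewrite Hp // mulrA mulrC.
rewrite NegzE NE (Hn n.+1) // big_nat_recr //= [RHS]mulrC invfM.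
rewrite -!mulrA mulVf ?lt0r_neq0 // mulr1.
by case: n => [|n]; [rewrite big_nil divr1 oppr0|rewrite Hn].
Qed.

(** Successive increments are multiplied by k > 0 and so keep the sign of the first one; s is that
    sign. *)
Lemma affine_recursion_sign y (k tau : R) : 0 < k ->
  (forall n, y (n + 1) = k * y n + tau) -> y 1 != y 0 ->
  exists2 s : R, s ^+ 2 = 1 & forall n, s * y n < s * y (n + 1).
Proof.
move=> k0 yS y10; pose s := Num.sg (y 1 - y 0).
exists s; first by rewrite sqr_sg subr_eq0 y10.
apply: int_shift_ind.
  by rewrite add0r -subr_gt0 -mulrBr -normrEsg normr_gt0 subr_eq0.
move=> n; rewrite -(subr_gt0 (s * y n)) -(subr_gt0 (s * y (n + 1))).
have -> : s * y (n + 1 + 1) - s * y (n + 1) = k * (s * y (n + 1) - s * y n).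
  by rewrite (yS (n + 1)) (yS n); ring.
by rewrite pmulr_rgt0.
Qed.

(** A discrete form of the fact that x / (1 + |x|) has derivative (1 + |x|)^-2. *)
Lemma bounded_slope (x y : R) : x <= y ->
  (y - x) / ((1 + `|x|) * (1 + `|y|)) <= y / (1 + `|y|) - x / (1 + `|x|).
Proof.
move=> xy; have x0 : 0 < 1 + `|x| by rewrite ltr_pwDl.
have y0 : 0 < 1 + `|y| by rewrite ltr_pwDl.
have -> : y / (1 + `|y|) - x / (1 + `|x|) =
   (y * (1 + `|x|) - x * (1 + `|y|)) / ((1 + `|x|) * (1 + `|y|)).
  by field; rewrite !lt0r_neq0.
rewrite ler_pM2r ?invr_gt0 ?mulr_gt0 //.
have [x_ge0|x_lt0] := leP 0 x; have [y_ge0|y_lt0] := leP 0 y.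
- by rewrite (ger0_norm x_ge0) (ger0_norm y_ge0); lra.
- lra.
- rewrite (ltr0_norm x_lt0) (ger0_norm y_ge0).
  have : 0 <= y * (- x) by rewrite mulr_ge0 //; lra.
  lra.
- by rewrite (ltr0_norm x_lt0) (ltr0_norm y_lt0); lra.
Qed.

(* The weights are proportional to (y (n + 1) - y n) / (1/4 + y n ^ 2), a
   Riemann sum of an integrable function, here dominated by the increments of
   the bounded function x / (1 + |x|). *)
Lemma affine_recursion_summable y c (k tau : R) : 0 < k ->
  (forall n, y (n + 1) = k * y n + tau) -> y 1 != y 0 ->
  (forall n, 0 < c n) ->
  (forall n, c (n + 1) * (1 / 4 + y (n + 1) ^+ 2) =
             k * (c n * (1 / 4 + y n ^+ 2))) ->
  (\esum_(n in [set: int]) (c n)%:E < +oo)%E.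
Proof.
move=> k0 yS y10 c0 cS; have [s s2 sy] := affine_recursion_sign k0 yS y10.
have [x [x2 xS dx]] : exists x : int -> R,
    [/\ forall n, x n ^+ 2 = y n ^+ 2, forall n, x (n + 1) = k * x n + s * tau &
        forall n, 0 < x (n + 1) - x n].
  exists (fun n => s * y n); split=> n; first by rewrite exprMn s2 mul1r.
    by rewrite yS; ring.
  by rewrite subr_gt0.
(* Both c n (1/4 + y n ^ 2) and the increment of x are multiplied by k at each step; C is their
   constant ratio. *)
pose C := c 0 * (1 / 4 + y 0 ^+ 2) / (x 1 - x 0).
have w0 n : 0 < 1 / 4 + y n ^+ 2 by rewrite ltr_pwDl // sqr_ge0.
have C0 : 0 < C.
  rewrite divr_gt0 ?mulr_gt0 //; have := dx 0; rewrite add0r //.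
have cE : forall n, c n * (1 / 4 + y n ^+ 2) = C * (x (n + 1) - x n).
  apply: int_shift_ind => [|n].
    by rewrite add0r /C divfK // lt0r_neq0 //; have := dx 0; rewrite add0r.
  rewrite cS; have -> : x (n + 1 + 1) - x (n + 1) = k * (x (n + 1) - x n).
    by rewrite xS {2}(xS n); ring.
  rewrite (mulrCA C); split=> [->//|].
  by apply: mulfI; rewrite lt0r_neq0.
(* Bounds the ratio of 1 + |x (n + 1)| to 1 + |x n|, so that the product in [bounded_slope] can be
   replaced by a square; 8 comes from (1 + |x|)^2 <= 8 (1/4 + x^2). *)
pose A := 1 + k + `|s * tau|.
have A0 : 0 < A by rewrite /A; have := normr_ge0 (s * tau); lra.
have K0 : 0 <= 8 * A * C.
  by apply: ltW; apply: mulr_gt0 => //; apply: mulr_gt0 => //; rewrite ltr0n.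
pose G n := 8 * A * C * (x n / (1 + `|x n|)).
have p0 (u : R) : 0 < 1 + `|u| by rewrite ltr_pwDl.
apply: (@esum_int_telescope _ G (8 * A * C)) => n; last first.
  rewrite /G normrM (ger0_norm K0) -[leRHS]mulr1 ler_wpM2l //.
  rewrite normrM normfV (gtr0_norm (p0 _)) ler_pdivrMr // mul1r.
  by rewrite lerDr.
rewrite (ltW (c0 n)) /=; apply: (@le_trans _ _ (8 * A * C *
   ((x (n + 1) - x n) / ((1 + `|x n|) * (1 + `|x (n + 1)|))))); last first.
  by rewrite /G -mulrBr; apply: ler_wpM2l => //; apply: bounded_slope; rewrite ltW // -subr_gt0.
have -> : c n = C * (x (n + 1) - x n) / (1 / 4 + y n ^+ 2).
  by rewrite -cE mulfK // lt0r_neq0.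
set D := (1 + `|x n|) * _.
have D0 : 0 < D by apply: mulr_gt0.
have q0 := dx n; move: (x (n + 1) - x n) q0 => q q0.
have -> : 8 * A * C * (q / D) = C * q * (8 * A / D) by move: D^-1 => D'; ring.
rewrite (ler_pM2l (mulr_gt0 C0 q0)) ler_pdivlMr // mulrC ler_pdivrMr //.
have I1 : 1 + `|x (n + 1)| <= A * (1 + `|x n|).
  have : `|x (n + 1)| <= k * `|x n| + `|s * tau|.
    by rewrite xS (le_trans (ler_normD _ _)) // normrM (gtr0_norm k0).
  have : 0 <= `|s * tau| * `|x n| by rewrite mulr_ge0.
  have : 0 <= `|x n| by [].
  by rewrite /A; lra.
have I2 : (1 + `|x n|) ^+ 2 <= 8 * (1 / 4 + y n ^+ 2).
  rewrite -x2 -[x n ^+ 2]real_normK ?num_real //.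
  have : 0 <= (1 - `|x n|) ^+ 2 by exact: sqr_ge0.
  have : 0 <= `|x n| ^+ 2 by exact: sqr_ge0.
  by rewrite !sqrrD sqrrN; lra.
apply: (@le_trans _ _ ((1 + `|x n|) * (A * (1 + `|x n|)))).
  by rewrite ler_pM2l.
by rewrite mulrCA -expr2 (mulrC 8) -mulrA ler_pM2l.
Qed.

End IntegerSequences.

(** * Orbits on the circle *)

Section CircleOrbits.
Set Implicit Arguments.
Unset Strict Implicit.
Variable R : realType.
Implicit Types (e b p z w : R[i]).

Lemma conjc_circle p : N p = 1 -> p^# = p^-1.
Proof.
move=> p1; have p0 : p != 0 by rewrite -mod_gt0 p1.
by apply: (mulfI p0); rewrite mulJ p1 expr1n divff.
Qed.

(** The modulus of the derivative of [moebius e b] at z, for every unimodular e. On the circle it is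
    also the Poisson kernel of b, whence the name. *)
Definition poisson_factor b z : R := (1 - N b ^+ 2) / N (1 - b^# * z) ^+ 2.

Lemma poisson_factor_gt0 b z : N b < 1 -> N z <= 1 -> 0 < poisson_factor b z.
Proof.
move=> b1 z1; apply: divr_gt0; first exact: subr_sqr_mod_gt0.
by rewrite exprn_gt0 // mod_gt0 moebius_den_neq0.
Qed.

Lemma one_sub_mulJ b : 1 - b * b^# = (1 - N b ^+ 2)%:C.
Proof. by rewrite mulJ rmorphB rmorph1. Qed.

Lemma mod_moebius_deriv e b z : N e = 1 -> N b < 1 ->
  N (e * (1 - b * b^#) / (1 - b^# * z) ^+ 2) = poisson_factor b z.
Proof.
move=> e1 b1; rewrite !modM e1 mul1r modV expr2 modM -expr2 one_sub_mulJ.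
by rewrite mod_real gtr0_norm // subr_sqr_mod_gt0.
Qed.

(** The conformal distortion identity |m z - m w|^2 = |m' z| |m' w| |z - w|^2. It governs both the
    distance of an orbit to the fixed point and the approach of m z to a boundary point. *)
Lemma sqr_mod_moebiusB e b z w : N e = 1 -> N b < 1 -> N z <= 1 -> N w <= 1 ->
  N (moebius e b z - moebius e b w) ^+ 2 =
  poisson_factor b z * poisson_factor b w * N (z - w) ^+ 2.
Proof.
move=> e1 b1 z1 w1; have zn0 := moebius_den_neq0 b1 z1.
have wn0 := moebius_den_neq0 b1 w1.
rewrite moebiusB // !modM modV modM e1 mul1r one_sub_mulJ.
rewrite mod_real gtr0_norm ?subr_sqr_mod_gt0 // /poisson_factor.
by rewrite -mod_eq0 in zn0; rewrite -mod_eq0 in wn0; field; rewrite zn0 wn0.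
Qed.

Lemma moebius_circleK e b z : N e = 1 -> N b < 1 -> N z = 1 ->
  N (moebius e^# (- e * b) z) = 1 /\ moebius e b (moebius e^# (- e * b) z) = z.
Proof.
move=> e1 b1 z1.
have b1' : N (- e * b) < 1 by rewrite modM modN e1 mul1r.
split; first by apply: moebius_circle; rewrite ?modJ.
have d0 := moebius_den_neq0 b1' (mod_le1 z1).
have en0 : e != 0 by rewrite -mod_gt0 e1.
have d1 : 1 - b * b^# != 0.
  by rewrite one_sub_mulJ -mod_gt0 mod_real normr_gt0 lt0r_neq0 // subr_sqr_mod_gt0.
have E w : w = - e * b -> w^# = - (e^-1 * b^#).
  by move=> ->; rewrite -(conjc_circle e1) -mulNr -rmorphN -rmorphM.
rewrite /moebius (E (- e * b) erefl) in d0 *; rewrite (conjc_circle e1).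
move: d0 d1 {E}; move: (b^#) => c d0 d1.
have dE : 1 - - (e^-1 * c) * z = (e + c * z) / e by field.
have d2 : e + c * z != 0 by apply: contraNN d0 => /eqP h; rewrite dE h mul0r.
rewrite dE.
have -> : e^-1 * (z - - e * b) / ((e + c * z) / e) = (z + e * b) / (e + c * z).
  by field; rewrite en0 d2.
have -> : (z + e * b) / (e + c * z) - b = (1 - b * c) * z / (e + c * z) by field.
have -> : 1 - c * ((z + e * b) / (e + c * z)) = e * (1 - b * c) / (e + c * z) by field.
by field; rewrite en0 d1 d2.
Qed.

Lemma Re_cayley p z : N p = 1 -> N z = 1 -> z != p ->
  complex.Re (p / (p - z)) = 1 / 2.
Proof.
move=> p1 z1 zp; have p0 : p != 0 by rewrite -mod_gt0 p1.
have z0 : z != 0 by rewrite -mod_gt0 z1.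
have pz : p - z != 0 by rewrite subr_eq0 eq_sym.
have zp' : z - p != 0 by rewrite subr_eq0.
have conjE : (p / (p - z))^# = p^-1 / (p^-1 - z^-1).
  by rewrite -(conjc_circle p1) -(conjc_circle z1) -rmorphB -conjc_inv -rmorphM.
apply: (@complexI R); rewrite ReJ_add conjE.
have pz' : p^-1 - z^-1 != 0.
  have -> : p^-1 - z^-1 = (z - p) / (p * z) by field; rewrite p0 z0.
  by rewrite mulf_neq0 // invr_neq0 // mulf_neq0.
have -> : p^-1 / (p^-1 - z^-1) = z / (z - p).
  have -> : p^-1 - z^-1 = (z - p) / (p * z) by field; rewrite p0 z0.
  by field; rewrite p0 z0 zp'.
rewrite rmorphM rmorph1 fmorphV rmorphMn rmorph1; congr (_ / _).
by rewrite -(opprB p z) invrN mulrN -mulrBl divff.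
Qed.

(* z |-> p / (p - z) maps the circle onto the line of real part 1/2 and p to
   infinity; it conjugates an automorphism fixing p to an affine map. *)
Lemma cayley_moebius e b p : N e = 1 -> N b < 1 -> N p = 1 ->
  moebius e b p = p -> exists tau : R, forall z, N z = 1 -> z != p ->
  complex.Im (p / (p - moebius e b z)) =
  (poisson_factor b p)^-1 * complex.Im (p / (p - z)) + tau.
Proof.
move=> e1 b1 p1 pp; have p0 : p != 0 by rewrite -mod_gt0 p1.
have dp := moebius_den_neq0 b1 (mod_le1 p1).
have d1 : 1 - b * b^# != 0.
  by rewrite one_sub_mulJ -mod_gt0 mod_real normr_gt0 lt0r_neq0 // subr_sqr_mod_gt0.
have en0 : e != 0 by rewrite -mod_gt0 e1.
have pb : p - b != 0.
  by rewrite subr_eq0; apply/eqP => pb; move: b1; rewrite -pb p1 ltxx.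
have eE : e = p * (1 - b^# * p) / (p - b).
  apply: (mulIf pb); rewrite divfK //; apply: (mulIf (invr_neq0 dp)).
  by rewrite -[LHS]/(moebius e b p) pp mulfK.
(* Writing 1 - b^# z as (1 - b^# p) + b^# (p - z) in the difference formula [moebiusB] splits off
   this constant. *)
pose s := p * (1 - b^# * p) * b^# / (e * (1 - b * b^#)).
(* The slope is the inverse of the derivative at p. That it is a positive real uses that p is fixed,
   through the expression [eE] of e. *)
have kE : ((poisson_factor b p)^-1)%:C = (1 - b^# * p) ^+ 2 / (e * (1 - b * b^#)).
  have -> : (poisson_factor b p)^-1 = N (1 - b^# * p) ^+ 2 / (1 - N b ^+ 2).
    by rewrite /poisson_factor invf_div.
  rewrite rmorphM fmorphV /= -one_sub_mulJ -mulJ.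
  have -> : (1 - b^# * p)^# = (p - b) / p.
    rewrite rmorphB rmorph1 rmorphM /= conjcK (conjc_circle p1).
    by field.
  by rewrite eE; field; rewrite p0 d1 dp pb.
exists (complex.Im s) => z z1 zp.
have dz := moebius_den_neq0 b1 (mod_le1 z1).
have pz : p - z != 0 by rewrite subr_eq0 eq_sym.
have -> : p / (p - moebius e b z) =
    ((poisson_factor b p)^-1)%:C * (p / (p - z)) + s.
  rewrite -{2}pp moebiusB ?mod_le1 // kE /s.
  by field; rewrite d1 en0 pz dz dp.
case: s (p / _) => [s1 s2] [x y] /=; ring.
Qed.

Lemma sqr_mod_cayley p z : N p = 1 -> N z = 1 -> z != p ->
  1 / 4 + complex.Im (p / (p - z)) ^+ 2 = (N (p - z) ^+ 2)^-1.
Proof.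
move=> p1 z1 zp; have := sqr_modE (p / (p - z)).
rewrite (Re_cayley p1 z1 zp) modM modV p1 mul1r exprVn => ->.
by congr (_ + _); field.
Qed.

Variables (e b p : R[i]) (t : int -> R[i]).
Hypotheses (e1 : N e = 1) (b1 : N b < 1) (p1 : N p = 1).
Hypotheses (pp : moebius e b p = p) (t1 : forall n, N (t n) = 1).
Hypotheses (tS : forall n, t (n + 1) = moebius e b (t n)) (t10 : t 1 != t 0).

Let y n := complex.Im (p / (p - t n)).

(** By the distortion identity the distance to p vanishes at all indices or at none, and at all
    would give t 1 = t 0. *)
Lemma orbit_neq_fixed n : t n != p.
Proof.
have st m : t m = p <-> t (m + 1) = p.
  split=> [h|h]; first by rewrite tS h.
  apply/eqP; rewrite -subr_eq0 -mod_eq0.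
  have := sqr_mod_moebiusB e1 b1 (mod_le1 (t1 m)) (mod_le1 p1).
  rewrite -tS h pp subrr mod0 expr0n /= => /esym/eqP.
  rewrite mulf_eq0 sqrf_eq0 => /orP[|//]; rewrite mulf_eq0.
  rewrite (gt_eqF (poisson_factor_gt0 b1 (mod_le1 (t1 m)))).
  by rewrite (gt_eqF (poisson_factor_gt0 b1 (mod_le1 p1))).
move: n; apply: int_shift_ind => [|n].
  apply/eqP => t0; move/eqP: t10; apply; rewrite t0.
  exact: (iffLR (st 0) t0).
by split=> /eqP h; apply/eqP => h'; apply: h; [exact: (iffRL (st n))|exact: (iffLR (st n))].
Qed.

Lemma orbit_cayley_step : exists tau, forall n,
  y (n + 1) = (poisson_factor b p)^-1 * y n + tau.
Proof.
have [tau H] := cayley_moebius e1 b1 p1 pp; exists tau => n.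
by rewrite /y tS H // orbit_neq_fixed.
Qed.

Lemma orbit_cayley_inj m n : y m = y n -> t m = t n.
Proof.
move=> ymn; have E : p / (p - t m) = p / (p - t n).
  apply/eqP; rewrite eq_complex; apply/andP; split; apply/eqP; last exact: ymn.
  by rewrite !Re_cayley // orbit_neq_fixed.
have p0 : p != 0 by rewrite -mod_gt0 p1.
by move/(mulfI p0)/invr_inj/addrI/oppr_inj: E.
Qed.

Lemma orbit_cayley10 : y 1 != y 0.
Proof. by apply/eqP => /orbit_cayley_inj/eqP; rewrite (negPf t10). Qed.

(** The Cayley coordinates are strictly monotone, so the orbit never returns. Sums over points of
    the orbit may then be indexed by the integers. *)
Lemma orbit_inj : injective t.
Proof.
have [tau yS] := orbit_cayley_step.
have k0 : 0 < (poisson_factor b p)^-1 by rewrite invr_gt0 poisson_factor_gt0 // p1.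
have [s s2 sy] := affine_recursion_sign k0 yS orbit_cayley10.
have lt := increasing_shift_lt sy.
move=> m n mn; have E : s * y m = s * y n by rewrite /y mn.
apply/eqP; rewrite eq_le !leNgt; apply/andP; split; apply/negP => /lt.
  by rewrite E ltxx.
by rewrite E ltxx.
Qed.

(** The distortion identity against p shows that the weight divided by |p - t n|^2 is multiplied at
    each step by the constant 1 / [poisson_factor b p], the slope of the affine map. *)
Lemma orbit_weights_summable (c : int -> R) : (forall n, 0 < c n) ->
  (forall n, c (n + 1) = poisson_factor b (t n) * c n) ->
  (\esum_(n in [set: int]) (c n)%:E < +oo)%E.
Proof.
move=> c0 cS; have [tau yS] := orbit_cayley_step.
have fp : 0 < poisson_factor b p by rewrite poisson_factor_gt0 // p1.
apply: (@affine_recursion_summable R y c _ tau _ yS orbit_cayley10 c0).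
  by rewrite invr_gt0.
move=> n; rewrite /y !sqr_mod_cayley ?orbit_neq_fixed //.
have := sqr_mod_moebiusB e1 b1 (mod_le1 p1) (mod_le1 (t1 n)).
rewrite pp -tS cS => ->.
have pn0 : N (p - t n) != 0 by rewrite mod_eq0 subr_eq0 eq_sym orbit_neq_fixed.
have fn : poisson_factor b (t n) != 0.
  by rewrite gt_eqF // poisson_factor_gt0 // t1.
by field; rewrite pn0 fn gt_eqF.
Qed.

End CircleOrbits.

(** * Forward and backward iterates on the circle *)

Section Iterates.
Set Implicit Arguments.
Unset Strict Implicit.
Variables (R : realType) (phi : R[i] -> R[i]) (e b : R[i]).
Hypotheses (e1 : N e = 1) (b1 : N b < 1).
Hypothesis phiE : forall z, N z <= 1 -> phi z = moebius e b z.

(** [pinv] only promises some preimage in the closed disc, once one is exhibited; it must lie on the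
    circle because the open disc is mapped into itself. *)
Lemma pinv_circle z : N z = 1 ->
  N (pinv closed_disc phi z) = 1 /\ phi (pinv closed_disc phi z) = z.
Proof.
move=> z1; have [w1 wz] := moebius_circleK e1 b1 z1.
set w := moebius _ _ z in w1 wz.
have zi : z \in [set phi x | x in closed_disc].
  by rewrite inE; exists w; [exact/closed_discE/mod_le1|rewrite phiE ?mod_le1].
have phiK : phi (pinv closed_disc phi z) = z by exact: pinvK.
have inv1 : N (pinv closed_disc phi z) <= 1.
  apply/closed_discE; apply: (@surjpinv_image_sub _ _ _ _ (phi @` closed_disc) phi).
    exact: subset_refl.
  by exists z => //; move: zi; rewrite inE.
split=> //; apply/eqP; rewrite eq_le inv1 /= leNgt; apply/negP => lt1.
have := moebius_disc e1 b1 lt1; rewrite -phiE // phiK z1 ltxx //.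
Qed.

Lemma iterz_circle a n : N a = 1 -> N (iterz phi n a) = 1.
Proof.
move=> a1; have S z : N z = 1 -> N (phi z) = 1.
  by move=> z1; rewrite phiE ?mod_le1 //; exact: moebius_circle.
case: n => k /=; first by elim: k => //= k IH; exact: S.
have {}S z : N z = 1 -> N (pinv closed_disc phi z) = 1 by move=> /pinv_circle[].
by apply: (S); elim: k => //= k IH; exact: S.
Qed.

Lemma iterzS a n : N a = 1 -> iterz phi (n + 1) a = phi (iterz phi n a).
Proof.
move=> a1; case: n => k.
  by have -> : Posz k + 1 = k.+1 by rewrite -addn1 PoszD.
have -> : Negz k + 1 = - k%:Z by rewrite NegzE -addn1 PoszD opprD subrK.
have := iterz_circle (- k%:Z) a1.
case: k => [|k] h; first by rewrite [RHS](pinv_circle a1).2.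
by rewrite -NegzE; symmetry; move: h; rewrite -NegzE => /pinv_circle[].
Qed.

End Iterates.

(** * Measures carried by an orbit *)

Section BorelSets.
Set Implicit Arguments.
Unset Strict Implicit.
Variable R : realType.
Notation C := (borelC R).

Lemma open_measurableC (U : set R[i]) : open U -> measurable (U : set C).
Proof. by move=> oU; apply: sub_sigma_algebra. Qed.

Lemma modP_open (U : set R[i]) :
  (forall z, U z -> exists2 d : R, 0 < d & forall w, N (w - z) < d -> U w) ->
  open U.
Proof.
by move=> UP; rewrite openE => z /UP Uz; rewrite /interior /=; apply/nbhs_modP.
Qed.

Lemma measurable_set1C (w : R[i]) : measurable ([set w] : set C).
Proof.
rewrite -[X in measurable X]setCK; apply: measurableC; apply: open_measurableC.
apply: modP_open => z /= zw; exists (N (w - z)).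
  by rewrite mod_gt0 subr_eq0; apply/eqP => /esym.
by move=> u uz uw; rewrite uw ltxx in uz.
Qed.

Lemma measurable_circle : measurable (circle : set C).
Proof.
rewrite -[X in measurable X]setCK; apply: measurableC; apply: open_measurableC.
apply: modP_open => z /= zw; exists `|N z - 1|.
  by rewrite normr_gt0 subr_eq0; apply/eqP => z1; apply: zw; apply/circleE.
move=> u uz /circleE u1; move: uz; rewrite -u1 ltNge => /negP; apply.
rewrite ler_norml; have := mod_dist z u; have := mod_dist u z.
by rewrite (modB z u); set x := N (u - z); lra.
Qed.

Lemma measurable_countableC (A : set R[i]) : countable A -> measurable (A : set C).
Proof.
exact: (@countable_measurable _ C _ measurable_set1C).
Qed.

Lemma countable_measure0 (mu : {measure set C -> \bar R}) (A : set R[i]) :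
  countable A -> (forall w, A w -> mu [set w] = 0%E) -> mu A = 0%E.
Proof.
move=> /countable_injP[f injf] A0.
have AE : A = \bigcup_(x in f @` A) [set 'pinv_(fun=> 0) A f x].
  apply/seteqP; split=> [w Aw|w [_ [u Au <-] ->]]; last first.
    by rewrite pinvKV ?inE.
  by exists (f w); [exists w|rewrite /= pinvKV ?inE].
rewrite AE measure_bigcup.
- by apply: eseries0 => i _; rewrite inE => -[u Au <-]; rewrite pinvKV ?inE ?A0.
- by move=> i _; exact: measurable_set1C.
- move=> i j [r Ar <-] [s As <-].
  by rewrite !pinvKV ?inE// => -[x [/= <- <-]].
Qed.

(** Continuity is available at circle points only, since kernels have their singularity inside the
    disc. The preimage of a ray is therefore compared, on the circle, with the open set U of points
    near which f exceeds a. *)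
Lemma measurable_fun_circle (f : C -> R) :
  (forall t, N t = 1 -> forall r : R, 0 < r -> exists2 d : R, 0 < d &
     forall w, N (w - t) < d -> `|f w - f t| < r) ->
  measurable_fun (circle : set C) f.
Proof.
move=> fc; apply: (measurability _ (measurable_realfun.RGenOInfty.measurableE R)) => //.
move=> /= _ [_ [a ->] <-].
pose U : set R[i] := [set t | exists2 d : R, 0 < d & forall w, N (w - t) < d -> a < f w].
have -> : circle `&` f @^-1` `]a, +oo[ = circle `&` U.
  apply/seteqP; split=> t [] /= t1; rewrite /= in_itv /= andbT => ft; split=> //.
    have [|d d0 dH] := fc t (iffLR (circleE t) t1) (f t - a).
      by rewrite subr_gt0.
    by exists d => // w /dH; rewrite ltr_norml; lra.
  by case: ft => d d0; apply; rewrite subrr mod0.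
apply: measurableI; first exact: measurable_circle.
apply: open_measurableC; apply: modP_open => t [d d0 dH].
exists (d / 2); first lra.
move=> w wt; exists (d / 2); first lra.
move=> u uw; apply: dH; rewrite -(subrKA w).
by apply: (le_lt_trans (modD _ _)); lra.
Qed.

Lemma measurable_fun_Re (f : R[i] -> R[i]) :
  (forall t, N t = 1 -> f w @[w --> t] --> f t) ->
  measurable_fun (circle : set C) (fun t : C => complex.Re (f t)).
Proof.
move=> fc; apply: measurable_fun_circle => t t1 r r0.
have /cvg_modP/(_ _ r0)[d d0 dH] := fc t t1; exists d => // w /dH.
by apply: le_lt_trans; rewrite -raddfB; exact: Re_le_mod.
Qed.

Lemma measurable_fun_Im (f : R[i] -> R[i]) :
  (forall t, N t = 1 -> f w @[w --> t] --> f t) ->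
  measurable_fun (circle : set C) (fun t : C => complex.Im (f t)).
Proof.
move=> fc; apply: measurable_fun_circle => t t1 r r0.
have /cvg_modP/(_ _ r0)[d d0 dH] := fc t t1; exists d => // w /dH.
by apply: le_lt_trans; rewrite -raddfB; exact: Im_le_mod.
Qed.

End BorelSets.

Section OrbitMeasures.
Set Implicit Arguments.
Unset Strict Implicit.
Variable R : realType.
Notation C := (borelC R).
Implicit Types (mu : {measure set C -> \bar R}) (t : int -> R[i]).

(** An enumeration 0, -1, 1, -2, ... of the integers, through which sums over the orbit become
    series over nat, the form taken by countable additivity. *)
Definition int_of_nat_zigzag (k : nat) : int := if odd k then Negz k./2 else Posz k./2.

Lemma zigzag_bij : set_bij [set: nat] [set: int] int_of_nat_zigzag.
Proof.
split => //.
- move=> i j _ _ E; rewrite -(odd_double_half i) -(odd_double_half j); move: E.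
  by rewrite /int_of_nat_zigzag; case: (odd i) (odd j) => -[] // [->].
- move=> [k|k] _; [exists k.*2|exists k.*2.+1] => //.
    by rewrite /int_of_nat_zigzag odd_double doubleK.
  by rewrite /int_of_nat_zigzag /= odd_double /= uphalf_double.
Qed.

Lemma trivIset_zigzag T (F : int -> set T) :
  trivIset setT F -> trivIset setT (F \o int_of_nat_zigzag).
Proof.
have [_ inj _] := zigzag_bij; move=> tF i j _ _ /tF h.
by apply: inj; rewrite ?inE //; exact: h.
Qed.

Lemma bigcup_zigzag T (F : int -> set T) :
  \bigcup_n F n = \bigcup_k (F \o int_of_nat_zigzag) k.
Proof.
have [_ _ surj] := zigzag_bij; apply/seteqP; split=> x [n _ Fx].
  by have [k _ kn] := surj n I; exists k => //=; rewrite kn.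
by exists (int_of_nat_zigzag n).
Qed.

Lemma measure_bigcup_int mu (F : int -> set C) :
  (forall n, measurable (F n)) -> trivIset setT F ->
  mu (\bigcup_n F n) = (\esum_(n in [set: int]) mu (F n))%E.
Proof.
move=> mF tF; rewrite bigcup_zigzag measure_bigcup;
  [|by move=> i _; exact: mF|exact: trivIset_zigzag].
rewrite (reindex_esum _ _ _ _ zigzag_bij) -nneseries_esumT; last by move=> n; exact: measure_ge0.
by apply: eq_eseriesl => k; rewrite in_setT.
Qed.

Lemma trivIset_orbit t (A : set C) : injective t ->
  trivIset setT (fun n => [set t n] `&` A).
Proof. by move=> ti m n _ _ [x [[/= -> _] [/= /ti -> _]]]. Qed.

Lemma range_zigzag t :
  range t = \bigcup_k ((fun n => [set t n]) \o int_of_nat_zigzag) k.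
Proof.
by rewrite -bigcup_zigzag; apply/seteqP; split=> z; [case=> n _ <-|case=> n _ ->]; exists n.
Qed.

Lemma measurable_orbit t : measurable (range t : set C).
Proof.
rewrite range_zigzag; apply: bigcupT_measurable => k; exact: measurable_set1C.
Qed.

Variables (mu : {measure set C -> \bar R}) (t : int -> R[i]) (c : int -> R).
Hypotheses (ti : injective t) (t1 : forall n, N (t n) = 1).
Hypotheses (mut : forall n, mu [set t n] = (c n)%:E).
Hypotheses (mu0 : mu (circle `\` range t) = 0%E).

Lemma measure_orbit_supported : mu (~` circle) = 0%E -> forall A : set C,
  measurable A ->
  mu A = (\esum_(n in [set: int]) ((c n)%:E * \d_(t n : C) A))%E.
Proof.
move=> muC A mA; have mO := measurable_orbit t; have mc := @measurable_circle R.
have AO : mu (A `\` range t) = 0%E.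
  have : mu (~` circle `|` (circle `\` range t)) = 0%E.
    rewrite measureU0 //; [exact: measurableC|exact: measurableD].
  apply: subset_measure0; [exact: measurableD| |].
    by apply: measurableU; [exact: measurableC|exact: measurableD].
  move=> z [Az zO]; case: (pselect (circle z)) => zc; [right|left] => //.
have -> : mu A = mu (A `&` range t).
  have := measureU0 (measurableI _ _ mA mO) (measurableD mA mO) AO.
  by rewrite setUIDK.
have -> : A `&` range t = \bigcup_n ([set t n] `&` A).
  apply/seteqP; split=> [z [Az [n _ tn]]|z [n _ [/= -> At]]].
    by exists n => //; split=> //; rewrite /= tn.
  by split=> //; exists n.
rewrite measure_bigcup_int;
  [|by move=> n; apply: measurableI => //; exact: measurable_set1C|exact: trivIset_orbit].
apply: eq_esum => n _; rewrite diracE.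
have [At|At] := pselect (A (t n)).
  rewrite (_ : [set t n] `&` A = [set t n]) ?mut ?mem_set ?mule1 //.
  by apply/seteqP; split=> z [] //= ->.
rewrite (_ : [set t n] `&` A = set0) ?measure0 ?memNset ?mule0 //.
by apply/seteqP; split=> z // [/= ->].
Qed.

(** The rest of the circle is negligible, and over a singleton an integral is value times mass. *)
Lemma ge0_integral_orbit (f : C -> \bar R) :
  measurable_fun (circle : set C) f -> (forall z : R[i], N z = 1 -> (0 <= f z)%E) ->
  (\int[mu]_(z in circle) f z =
   \esum_(n in [set: int]) (f (t n) * (c n)%:E))%E.
Proof.
move=> mf f0; have mO := measurable_orbit t; have mc := @measurable_circle R.
have Oc : range t `<=` circle by move=> z [n _ <-]; exact/circleE.
have f0' z : circle z -> (0 <= f z)%E by move=> /circleE; exact: f0.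
rewrite (ge0_negligible_integral (measurableD mc mO) mc mf f0' mu0).
have -> : circle `\` (circle `\` range t) = range t.
  apply/seteqP; split=> [z [zc h]|z [n _ <-]].
    by apply: contrapT => zO; apply: h.
  split; [exact/circleE|by case=> _; apply; exists n].
have OE := range_zigzag t.
rewrite OE ge0_integral_bigcup.
- rewrite (reindex_esum _ _ _ _ zigzag_bij) -nneseries_esumT; last first.
    by move=> n; rewrite mule_ge0 // ?f0 // -mut measure_ge0.
  apply: eq_eseriesr => k _ /=; rewrite -mut.
  rewrite (eq_integral (cst (f (t (int_of_nat_zigzag k))))); last first.
    by move=> z; rewrite inE /= => ->.
  by rewrite integral_cst //; exact: measurable_set1C.
- by move=> k; exact: measurable_set1C.
- by rewrite -OE; exact: measurable_funS mf.
- by rewrite -OE => z /Oc; exact: f0'.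
- apply: trivIset_zigzag => m n _ _ [x [/= -> /ti]] //.
Qed.

End OrbitMeasures.

(** * The Herglotz kernel and its covariance under Moebius maps *)

Section HerglotzKernel.
Set Implicit Arguments.
Unset Strict Implicit.
Variable R : realType.
Implicit Types (e b z t s : R[i]).

Definition herglotz z t : R[i] := (t + z) / (t - z).

Lemma cvg_idC t : (fun w : R[i] => w) w @[w --> t] --> t.
Proof. by apply/cvg_modP => e e0; exists e. Qed.

Lemma circle_neq_disc z t : N z < 1 -> N t = 1 -> t - z != 0.
Proof.
by move=> z1 t1; rewrite subr_eq0; apply/eqP => tz; rewrite -tz t1 ltxx in z1.
Qed.

Lemma herglotz_continuous z t : N z < 1 -> N t = 1 ->
  herglotz z w @[w --> t] --> herglotz z t.
Proof.
move=> z1 t1; apply: cvgMC; first exact: cvgDC (@cvg_idC t) (@cvg_cstC _ z t).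
apply: cvgVC; first exact: circle_neq_disc.
exact: cvgDC (@cvg_idC t) (@cvg_cstC _ (- z) t).
Qed.

Lemma mod_circle_disc z t : N t = 1 -> 1 - N z <= N (t - z).
Proof. by move=> t1; rewrite -{1}t1; exact: mod_dist. Qed.

Lemma herglotz_bounded z t : N z < 1 -> N t = 1 ->
  N (herglotz z t) <= 2 / (1 - N z).
Proof.
move=> z1 t1; rewrite modM modV; have z0 : 0 < 1 - N z by rewrite subr_gt0.
apply: ler_pM; rewrite ?mod_ge0 ?invr_ge0 ?mod_ge0 //.
  by apply: (le_trans (modD _ _)); rewrite t1; lra.
rewrite lef_pV2 ?posrE ?mod_gt0 ?circle_neq_disc //; exact: mod_circle_disc.
Qed.

Lemma Re_herglotz z t : N z < 1 -> N t = 1 ->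
  complex.Re (herglotz z t) = (1 - N z ^+ 2) / N (t - z) ^+ 2.
Proof.
move=> z1 t1; have tz := circle_neq_disc z1 t1.
have E : (t - z)^-1 = (t - z)^# * ((N (t - z) ^+ 2)^-1)%:C.
  by apply: (mulfI tz); rewrite divff // mulrA mulJ -rmorphM divff // expf_neq0 // mod_eq0.
have -> : 1 - N z ^+ 2 = complex.Re ((t + z) * (t - z)^#).
  rewrite -(expr1n _ 2) -t1 !sqr_modE; case: t {t1 tz E} => a c; case: z {z1} => u v /=.
  by ring.
rewrite /herglotz E mulrA.
by case: ((t + z) * (t - z)^#) => x y /=; rewrite mulr0 subr0.
Qed.

Lemma sqr_mod_moebius_den_circle b t : N t = 1 ->
  N (1 - b^# * t) ^+ 2 = N (t - b) ^+ 2.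
Proof.
move=> t1; have := sqr_mod_moebius_den b t.
by rewrite t1 expr1n subrr mulr0 => /eqP; rewrite subr_eq0 => /eqP.
Qed.

Lemma poisson_factor_herglotz b t : N b < 1 -> N t = 1 ->
  poisson_factor b t = complex.Re (herglotz b t).
Proof.
by move=> b1 t1; rewrite Re_herglotz // /poisson_factor sqr_mod_moebius_den_circle.
Qed.

(** On the circle this is 2i Im (b^# s) / |1 - b^# s|^2, which is purely imaginary, as covariance of
    the Poisson kernel requires. It is written without the conjugate of s to make the covariance a
    rational identity. *)
Definition herglotz_defect b s : R[i] :=
  (b^# * (s * s) - b) / ((1 - b^# * s) * (s - b)).

Lemma herglotz_defect_continuous b s : N b < 1 -> N s = 1 ->
  herglotz_defect b w @[w --> s] --> herglotz_defect b s.
Proof.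
move=> b1 s1; have cs := @cvg_idC s.
apply: cvgMC.
  exact: cvgDC (cvgMC (@cvg_cstC _ b^# s) (cvgMC cs cs)) (@cvg_cstC _ (- b) s).
apply: cvgVC.
  by apply: mulf_neq0; [exact: moebius_den_neq0 b1 (mod_le1 s1)|exact: circle_neq_disc].
apply: cvgMC; last exact: cvgDC cs (@cvg_cstC _ (- b) s).
exact: cvgDC (@cvg_cstC _ 1 s) (cvgNC (cvgMC (@cvg_cstC _ b^# s) cs)).
Qed.

(* The Poisson kernel is covariant: [P(m z, m s) |m' s| = P(z, s)]. For its
   holomorphic completion this holds up to a term independent of z. *)
Lemma herglotz_moebius e b z s : N e = 1 -> N b < 1 -> N z < 1 -> N s = 1 ->
  (poisson_factor b s)%:C * herglotz (moebius e b z) (moebius e b s) =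
  herglotz z s + herglotz_defect b s.
Proof.
move=> e1 b1 z1 s1; have s0 : s != 0 by rewrite -mod_gt0 s1.
have e0 : e != 0 by rewrite -mod_gt0 e1.
have ds := moebius_den_neq0 b1 (mod_le1 s1).
have dz := moebius_den_neq0 b1 (ltW z1).
have sb := circle_neq_disc b1 s1; have sz := circle_neq_disc z1 s1.
have d1 : 1 - b * b^# != 0.
  by rewrite one_sub_mulJ -mod_gt0 mod_real normr_gt0 lt0r_neq0 // subr_sqr_mod_gt0.
(* On the circle the conjugate of 1 - b^# s is (s - b) / s, so the real factor is a rational
   expression in s. *)
have -> : (poisson_factor b s)%:C = (1 - b * b^#) * s / ((1 - b^# * s) * (s - b)).
  rewrite /poisson_factor rmorphM fmorphV /= -one_sub_mulJ -mulJ.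
  have -> : (1 - b^# * s)^# = (s - b) / s.
    rewrite rmorphB rmorph1 rmorphM /= conjcK (conjc_circle s1).
    by field.
  by field; rewrite s0 ds sb.
rewrite /herglotz moebiusB ?(ltW z1) ?s1 // /moebius /herglotz_defect.
move: (b^#) ds dz d1 => b' ds dz d1.
by field; rewrite e0 ds dz sb sz d1.
Qed.

End HerglotzKernel.

Section CircleIntegrals.
Set Implicit Arguments.
Unset Strict Implicit.
Variable R : realType.
Notation C := (borelC R).
Variable mu : {measure set C -> \bar R}.
Hypothesis mu_fin : (mu circle < +oo)%E.

Lemma bounded_integrable_circle (f : C -> R) (M : R) :
  measurable_fun (circle : set C) f ->
  (forall t : R[i], N t = 1 -> `|f t| <= M) ->
  mu.-integrable circle (EFin \o f).
Proof.
move=> mf fM; apply: measurable_bounded_integrable => //.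
  exact: measurable_circle.
exists M; split; first exact: num_real.
move=> y My t /circleE tc; exact: le_trans (fM t tc) (ltW My).
Qed.

Lemma integrable_Re (f : R[i] -> R[i]) (M : R) :
  (forall t, N t = 1 -> f w @[w --> t] --> f t) ->
  (forall t, N t = 1 -> N (f t) <= M) ->
  mu.-integrable circle (EFin \o (fun t : C => complex.Re (f t))).
Proof.
move=> fc fM; apply: (@bounded_integrable_circle _ M); first exact: measurable_fun_Re.
by move=> t /fM; apply: le_trans; exact: Re_le_mod.
Qed.

Lemma integrable_Im (f : R[i] -> R[i]) (M : R) :
  (forall t, N t = 1 -> f w @[w --> t] --> f t) ->
  (forall t, N t = 1 -> N (f t) <= M) ->
  mu.-integrable circle (EFin \o (fun t : C => complex.Im (f t))).
Proof.
move=> fc fM; apply: (@bounded_integrable_circle _ M); first exact: measurable_fun_Im.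
by move=> t /fM; apply: le_trans; exact: Im_le_mod.
Qed.

Lemma cintegralD (f g : R[i] -> R[i]) (M M' : R) :
  (forall t, N t = 1 -> f w @[w --> t] --> f t) ->
  (forall t, N t = 1 -> g w @[w --> t] --> g t) ->
  (forall t, N t = 1 -> N (f t) <= M) -> (forall t, N t = 1 -> N (g t) <= M') ->
  cintegral mu circle (fun t => f t + g t) =
  cintegral mu circle f + cintegral mu circle g.
Proof.
move=> fc gc fM gM; have mc := @measurable_circle R; rewrite /cintegral.
have -> : (fun t : C => complex.Re (f t + g t)) =
    (fun t : C => complex.Re (f t) + complex.Re (g t)).
  by apply/funext => t; rewrite raddfD.
have -> : (fun t : C => complex.Im (f t + g t)) =
    (fun t : C => complex.Im (f t) + complex.Im (g t)).
  by apply/funext => t; rewrite raddfD.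
rewrite RintegralD //; [|exact: integrable_Re fc fM|exact: integrable_Re gc gM].
by rewrite RintegralD //; [exact: integrable_Im fc fM|exact: integrable_Im gc gM].
Qed.

End CircleIntegrals.

(** * Recovering the atoms from the Poisson integral *)

Section AtomLimit.
Set Implicit Arguments.
Unset Strict Implicit.
Variable R : realType.
Notation C := (borelC R).
Variable mu : {measure set C -> \bar R}.
Hypothesis mu_fin : (mu circle < +oo)%E.
Implicit Types (w : R[i]) (z : nat -> R[i]).

Definition poisson_integral (z : R[i]) : R :=
  \int[mu]_(t in circle) complex.Re (herglotz z t).

Lemma cvg_pinch (u v : nat -> R) (l K : R) :
  (forall n, `|u n - l| <= K * v n) -> v n @[n --> \oo] --> 0 ->
  u n @[n --> \oo] --> l.
Proof.
move=> uv v0; apply/(@subr_cvg0 _ R^o); apply: (@squeeze_cvgr _ _ _ _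
  (fun n => - (K * v n)) (fun n => K * v n)).
- by apply: nearW => n; rewrite -ler_norml; exact: uv.
- by rewrite -oppr0 -(mulr0 K); apply: cvgN; apply: cvgM v0; exact: cvg_cst.
- by rewrite -(mulr0 K); apply: cvgM v0; exact: cvg_cst.
Qed.

Lemma one_sub_sqr_mod_le (z w : R[i]) : N z < 1 -> N w = 1 ->
  0 <= 1 - N z ^+ 2 <= 2 * N (w - z).
Proof.
move=> z1 w1; have := mod_circle_disc z w1; have := mod_ge0 z => z0 d.
have := sqr_ge0 (1 - N z); rewrite sqrrB expr1n mul1r => h.
have : N z ^+ 2 <= 1 by rewrite expr_le1 ?mod_ge0 // ltW.
by move=> h'; apply/andP; split; lra.
Qed.

(** The product is (1 - |z|^2)^2 / |t - z|^2 and 1 - |z|^2 <= 2 |t - z|. The constant 4 is the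
    dominating function in [poisson_integral_atom]. *)
Lemma poisson_weighted_le (z t : R[i]) : N z < 1 -> N t = 1 ->
  0 <= (1 - N z ^+ 2) * complex.Re (herglotz z t) <= 4.
Proof.
move=> z1 t1; have /andP[h0 h] := one_sub_sqr_mod_le z1 t1.
have tz0 : 0 < N (t - z) by rewrite mod_gt0 circle_neq_disc.
rewrite Re_herglotz // mulrA -expr2 divr_ge0 ?sqr_ge0 //=.
rewrite ler_pdivrMr ?exprn_gt0 //.
have -> : 4 * N (t - z) ^+ 2 = (2 * N (t - z)) ^+ 2 by rewrite exprMn; congr (_ * _); ring.
by rewrite ler_pXn2r // nnegrE // mulr_ge0 // ltW.
Qed.

Lemma poisson_weighted_cvg0 w z (t : R[i]) : N w = 1 -> (forall n, N (z n) < 1) ->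
  N (w - z n) @[n --> \oo] --> 0 -> N t = 1 -> t != w ->
  ((1 - N (z n) ^+ 2) * complex.Re (herglotz (z n) t)) @[n --> \oo] --> 0.
Proof.
move=> w1 z1 zw t1 tw; pose d := N (t - w).
have d0 : 0 < d by rewrite mod_gt0 subr_eq0.
(* Eventually |t - z n| >= d / 2, while 1 - |z n|^2 <= 2 |w - z n|; squaring the quotient gives 16 /
   d^2. *)
apply: (@squeeze_cvgr _ _ _ _ (fun=> 0)
  (fun n => 16 / d ^+ 2 * (N (w - z n) * N (w - z n)))).
- have /cvgrPdist_lt/(_ (d / 2)) := zw; rewrite divr_gt0 // => /(_ isT).
  apply: filterS => n; rewrite sub0r normrN ger0_norm ?mod_ge0 // => hn.
  have /andP[-> _] /= := poisson_weighted_le (z1 n) t1.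
  have /andP[h0 h] := one_sub_sqr_mod_le (z1 n) w1.
  have hd : d / 2 <= N (t - z n).
    rewrite -(subrKA w) -[w - z n]opprB.
    by have := mod_dist (t - w) (z n - w); rewrite -/d (modB (z n)); lra.
  rewrite Re_herglotz // mulrA -expr2.
  have tz0 : 0 < N (t - z n) by lra.
  rewrite ler_pdivrMr ?exprn_gt0 //.
  have -> : 16 / d ^+ 2 * (N (w - z n) * N (w - z n)) * N (t - z n) ^+ 2 =
     (2 * N (w - z n) * (2 / d * N (t - z n))) ^+ 2 by field; rewrite lt0r_neq0.
  rewrite ler_pXn2r ?nnegrE //; last first.
    by rewrite !mulr_ge0 ?mod_ge0 // ?invr_ge0 // ltW.
  apply: (le_trans h); rewrite -{1}[2 * N _]mulr1 ler_wpM2l ?mulr_ge0 ?mod_ge0 //.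
  by rewrite mulrAC ler_pdivlMr // mul1r; lra.
- exact: cvg_cst.
- rewrite -[X in _ --> X](mulr0 (16 / d ^+ 2)); apply: cvgM; first exact: cvg_cst.
  by rewrite -[X in _ --> X](mulr0 0); exact: cvgM.
Qed.

(** By dominated convergence the weighted kernels tend to l times the indicator of w. The parameter
    l records how z n approaches w, so that the lemma applies both to a radial sequence and to its
    image. *)
Lemma poisson_integral_atom w z (l : R) : N w = 1 -> (forall n, N (z n) < 1) ->
  N (w - z n) @[n --> \oo] --> 0 ->
  ((1 - N (z n) ^+ 2) ^+ 2 / N (w - z n) ^+ 2) @[n --> \oo] --> l ->
  ((1 - N (z n) ^+ 2) * poisson_integral (z n)) @[n --> \oo] -->
     l * fine (mu [set w]).
Proof.
move=> w1 z1 zw zl; have mc := @measurable_circle R.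
have ms := @measurable_set1C R w.
pose f_ (n : nat) (t : C) : \bar R :=
  ((1 - N (z n) ^+ 2) * complex.Re (herglotz (z n) t))%:E.
pose f (t : C) : \bar R := (l * \1_[set w] t)%:E.
have mK n : measurable_fun (circle : set C) (fun t : C => complex.Re (herglotz (z n) t)).
  by apply: measurable_fun_Re => t; exact: herglotz_continuous.
have iK n : mu.-integrable circle (EFin \o (fun t : C => complex.Re (herglotz (z n) t))).
  apply: integrable_Re => //; first by move=> t; exact: herglotz_continuous.
  by move=> t; exact: herglotz_bounded.
have mf_ n : measurable_fun (circle : set C) (f_ n).
  by apply/measurable_EFinP; apply: measurable_funM => //; exact: measurable_cst.
have mi : measurable_fun (circle : set C) (\1_[set w] : C -> R).
  exact: measurable_indic.
have mf : measurable_fun (circle : set C) f.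
  by apply/measurable_EFinP; apply: measurable_funM => //; exact: measurable_cst.
have ii : mu.-integrable circle (EFin \o (\1_[set w] : C -> R)).
  apply: (@bounded_integrable_circle _ _ mu_fin _ 1) => //.
  by move=> t _; rewrite indicE; case: (_ \in _); rewrite ?normr1 ?normr0.
have ig : mu.-integrable circle (EFin \o (cst 4 : C -> R)).
  by apply: (@bounded_integrable_circle _ _ mu_fin _ 4) => // t _; rewrite ger0_norm.
have point (t : C) : circle t -> f_ x0 t @[x0 --> \oo] --> f t.
  move=> /circleE t1; apply: cvg_EFin; first exact: nearW.
  rewrite /f indicE; have [tw|tw] := eqVneq (t : R[i]) w.
    rewrite tw mem_set // mulr1; move: zl; apply: cvg_trans.
    apply: near_eq_cvg; apply: nearW => n /=.
    by rewrite Re_herglotz // mulrA -expr2.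
  rewrite memNset; last by move=> /= E; rewrite E eqxx in tw.
  by rewrite mulr0; exact: (poisson_weighted_cvg0 w1 z1 zw t1 tw).
have dom (t : C) n : circle t -> (`|f_ n t| <= (4 : R)%:E)%E.
  move=> /circleE t1; have /andP[h0 h4] := poisson_weighted_le (z1 n) t1.
  by rewrite /f_ abse_EFin /= lee_fin ger0_norm.
have [_ _] := dominated_convergence mc mf_ mf
  (aeW mu point) ig (aeW mu (fun t n => @dom t n)).
have -> : (\int[mu]_(t in circle) f t)%E = (l * fine (mu [set w]))%:E.
  rewrite -[LHS]fineK; last exact: integrable_fin_num (integrableZl mc l ii).
  congr EFin; rewrite -[LHS]/(\int[mu]_(t in circle) (l * \1_[set w] t)).
  rewrite RintegralZl // /Rintegral integral_indic //.
  by congr (_ * fine (mu _)); apply/setIidl => _ ->; exact/circleE.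
move=> /fine_cvg; apply: cvg_trans; apply: near_eq_cvg; apply: nearW => n /=.
by rewrite -RintegralZl.
Qed.

End AtomLimit.

Section EigenfunctionAtoms.
Set Implicit Arguments.
Unset Strict Implicit.
Variable R : realType.
Notation C := (borelC R).
Variable mu : {measure set C -> \bar R}.
Hypothesis mu_fin : (mu circle < +oo)%E.
Variables (e b : R[i]).
Hypotheses (e1 : N e = 1) (b1 : N b < 1).

Lemma mod_singular_function (z : R[i]) :
  N (singular_function mu z) = expR (- poisson_integral mu z).
Proof. by rewrite /singular_function mod_cexp. Qed.

(** Taking moduli turns the eigenvalue equation into one between exponentials. Expressing the
    additive constant by values at 0 avoids a logarithm of |lambda|. *)
Lemma eigenfunction_poisson_integral (lambda : R[i]) :
  (forall z, N z < 1 ->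
     singular_function mu (moebius e b z) = lambda * singular_function mu z) ->
  forall z, N z < 1 -> poisson_integral mu (moebius e b z) =
    poisson_integral mu z +
    (poisson_integral mu (moebius e b 0) - poisson_integral mu 0).
Proof.
move=> H; have E z : N z < 1 ->
    expR (poisson_integral mu z - poisson_integral mu (moebius e b z)) = N lambda.
  move=> /H /(congr1 N); rewrite modM !mod_singular_function => h.
  by rewrite expRD h mulrCA -expRD subrr expR0 mulr1.
have N0 : N (0 : R[i]) < 1 by rewrite mod0.
move=> z z1; have := E z z1; rewrite -(E 0 N0) => /expR_inj.
move: (poisson_integral mu z) (poisson_integral mu (moebius e b z)) => p q.
move: (poisson_integral mu 0) (poisson_integral mu _) => p0 q0; lra.
Qed.

Lemma moebius_mod_poisson (z : R[i]) : N z <= 1 ->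
  1 - N (moebius e b z) ^+ 2 = poisson_factor b z * (1 - N z ^+ 2).
Proof. by move=> z1; rewrite moebius_mod // /poisson_factor mulrAC. Qed.

Lemma poisson_factor_le (z : R[i]) : N z <= 1 ->
  poisson_factor b z <= (1 - N b ^+ 2) / (1 - N b) ^+ 2.
Proof.
move=> z1; have b0 : 0 < 1 - N b by rewrite subr_gt0.
rewrite ler_pM2l ?subr_sqr_mod_gt0 // lef_pV2 ?posrE ?exprn_gt0 //; last first.
  by rewrite mod_gt0 moebius_den_neq0.
rewrite ler_pXn2r ?nnegrE ?mod_ge0 ?(ltW b0) //.
have := mod_dist 1 (b^# * z); rewrite mod1 modM modJ.
have : N b * N z <= N b * 1 by rewrite ler_wpM2l ?mod_ge0.
lra.
Qed.

Lemma poisson_factor_cvg (w : R[i]) (z : nat -> R[i]) : N w = 1 ->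
  N (w - z n) @[n --> \oo] --> 0 ->
  poisson_factor b (z n) @[n --> \oo] --> poisson_factor b w.
Proof.
move=> w1 zw; apply: cvgM; first exact: cvg_cst.
have Ncvg : N (1 - b^# * z n) @[n --> \oo] --> N (1 - b^# * w).
  apply: (@cvg_pinch _ _ (fun n => N (w - z n)) _ (N b)) zw => n.
  have -> : N b * N (w - z n) = N ((1 - b^# * z n) - (1 - b^# * w)).
    by rewrite -modJ -modM; congr N; ring.
  rewrite ler_norml; have := mod_dist (1 - b^# * z n) (1 - b^# * w).
  have := mod_dist (1 - b^# * w) (1 - b^# * z n).
  by rewrite (modB (1 - b^# * w)); lra.
apply: cvgV; last by rewrite expr2; apply: cvgM.
by rewrite expf_neq0 // mod_eq0 moebius_den_neq0 // w1.
Qed.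

Lemma atom_moebius (K : R) (w : R[i]) : N w = 1 ->
  (forall z, N z < 1 ->
    poisson_integral mu (moebius e b z) = poisson_integral mu z + K) ->
  fine (mu [set moebius e b w]) = poisson_factor b w * fine (mu [set w]).
Proof.
move=> w1 H; pose h (n : nat) : R := n.+1%:R^-1.
have h01 n : 0 < h n <= 1.
  by rewrite invr_gt0 ltr0n /= invf_le1 ?ltr0n // ler1n.
have h_cvg : h n @[n --> \oo] --> 0 by exact: cvg_harmonic.
pose z n := (1 - h n)%:C * w.
have Nz n : N (z n) = 1 - h n.
  by rewrite modM w1 mulr1 mod_real ger0_norm //; have := h01 n; lra.
have z1 n : N (z n) < 1 by rewrite Nz; have := h01 n; lra.
have wz n : N (w - z n) = h n.
  rewrite /z -{1}(mul1r w) -mulrBl modM w1 mulr1 rmorphB rmorph1 opprB addrC subrK.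
  by rewrite mod_real gtr0_norm //; have := h01 n; lra.
have zw : N (w - z n) @[n --> \oo] --> 0.
  by rewrite (_ : (fun n => N (w - z n)) = h) //; apply/funext.
have Dw : 0 < poisson_factor b w by rewrite poisson_factor_gt0 // w1.
have Dz n : 0 < poisson_factor b (z n) by rewrite poisson_factor_gt0 // ltW.
(* With |z n| = 1 - h the quotient is (2 - h)^2. *)
have u_cvg : ((1 - N (z n) ^+ 2) ^+ 2 / N (w - z n) ^+ 2) @[n --> \oo] --> (4 : R).
  have -> : (fun n => (1 - N (z n) ^+ 2) ^+ 2 / N (w - z n) ^+ 2) =
      (fun n => (2 - h n) * (2 - h n)).
    apply/funext => n; rewrite wz Nz.
    by have [/andP[hn _]] := h01 n; field; rewrite lt0r_neq0.
  have -> : (4 : R) = (2 - 0) * (2 - 0) by ring.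
  by apply: cvgM; apply: cvgB => //; exact: cvg_cst.
have D_cvg := poisson_factor_cvg w1 zw.
pose m := moebius e b.
have mw1 : N (m w) = 1 by exact: moebius_circle.
have mz1 n : N (m (z n)) < 1 by exact: moebius_disc.
have mB n : N (m w - m (z n)) ^+ 2 =
    poisson_factor b w * poisson_factor b (z n) * N (w - z n) ^+ 2.
  by apply: sqr_mod_moebiusB; rewrite ?w1 // ltW.
have mzw : N (m w - m (z n)) @[n --> \oo] --> 0.
  pose B := (1 - N b ^+ 2) / (1 - N b) ^+ 2.
  have B0 : 0 <= B by apply: le_trans (poisson_factor_le (mod_le1 w1)); exact: ltW.
  apply: (@cvg_pinch _ _ (fun n => N (w - z n)) _ B) zw => n.
  rewrite subr0 ger0_norm ?mod_ge0 //.
  have Bh : 0 <= B * N (w - z n) by exact: mulr_ge0 B0 (mod_ge0 _).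
  rewrite -(ler_pXn2r (ltn0Sn 1)) ?nnegrE ?mod_ge0 ?Bh // mB exprMn.
  rewrite ler_wpM2r ?sqr_ge0 // expr2; apply: ler_pM; try exact: ltW.
    exact: poisson_factor_le (mod_le1 w1).
  exact: poisson_factor_le (ltW (z1 n)).
(* The image sequence need not be radial, but its quotient differs from the radial one by the factor
   |m' (z n)| / |m' w|, which tends to 1. *)
have mu_cvg : ((1 - N (m (z n)) ^+ 2) ^+ 2 / N (m w - m (z n)) ^+ 2)
    @[n --> \oo] --> (4 : R).
  have -> : (fun n => (1 - N (m (z n)) ^+ 2) ^+ 2 / N (m w - m (z n)) ^+ 2) =
      (fun n => (poisson_factor b (z n) / poisson_factor b w) *
        ((1 - N (z n) ^+ 2) ^+ 2 / N (w - z n) ^+ 2)).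
    apply/funext => n; rewrite mB moebius_mod_poisson ?(ltW (z1 n)) //.
    have [/andP[hn _]] := h01 n.
    by rewrite wz; field; rewrite !lt0r_neq0.
  rewrite -[X in _ --> X]mul1r; apply: cvgM => //.
  rewrite -(divff (lt0r_neq0 Dw)); apply: cvgM => //; exact: cvg_cst.
have A := poisson_integral_atom mu_fin w1 z1 zw u_cvg.
have B := poisson_integral_atom mu_fin mw1 mz1 mzw mu_cvg.
(* The same sequence computed from z n. The constant K drops out because its weight 1 - |z n|^2
   tends to 0. *)
have B' : ((1 - N (m (z n)) ^+ 2) * poisson_integral mu (m (z n)))
    @[n --> \oo] --> poisson_factor b w * (4 * fine (mu [set w]) + 0 * K).
  have -> : (fun n => (1 - N (m (z n)) ^+ 2) * poisson_integral mu (m (z n))) =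
     (fun n => poisson_factor b (z n) *
        ((1 - N (z n) ^+ 2) * poisson_integral mu (z n) + (1 - N (z n) ^+ 2) * K)).
    apply/funext => n; rewrite moebius_mod_poisson ?(ltW (z1 n)) // H //.
    by rewrite -mulrDr mulrA.
  apply: cvgM => //; apply: cvgD => //; apply: cvgM; last exact: cvg_cst.
  apply: (@cvg_pinch _ _ (fun n => N (w - z n)) _ 2) zw => n.
  by have /andP[h0 h2] := one_sub_sqr_mod_le (z1 n) w1; rewrite subr0 ger0_norm.
have n4 : (4 : R) != 0 by rewrite pnatr_eq0.
by apply: (mulfI n4); rewrite (cvg_unique (@Rhausdorff R) B B'); ring.
Qed.

End EigenfunctionAtoms.

(** * Change of variables for integrals against the orbit measure *)

Section TransferOfIntegrals.
Set Implicit Arguments.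
Unset Strict Implicit.
Variable R : realType.
Notation C := (borelC R).
Variables (mu : {measure set C -> \bar R}) (e b : R[i]).
Variables (t : int -> R[i]) (c : int -> R).
Hypotheses (e1 : N e = 1) (b1 : N b < 1).
Hypotheses (ti : injective t) (t1 : forall n, N (t n) = 1).
Hypothesis (tS : forall n, t (n + 1) = moebius e b (t n)).
Hypothesis (cS : forall n, c (n + 1) = poisson_factor b (t n) * c n).
Hypotheses (mut : forall n, mu [set t n] = (c n)%:E).
Hypotheses (mu0 : mu (circle `\` range t) = 0%E) (mu_fin : (mu circle < +oo)%E).

Lemma shift_bij : set_bij [set: int] [set: int] (fun n => n + 1).
Proof.
split=> // [m n _ _ /addIr//|n _]; exists (n - 1) => //; exact: subrK.
Qed.

(** Both integrals are sums over the orbit, and the recursion for c makes the term of f at n + 1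
    equal to the term of g at n. *)
Lemma ge0_integral_moebius (f g : C -> R) :
  measurable_fun (circle : set C) f -> measurable_fun (circle : set C) g ->
  (forall s : R[i], N s = 1 -> 0 <= f s) ->
  (forall s : R[i], N s = 1 -> g s = poisson_factor b s * f (moebius e b s)) ->
  \int[mu]_(s in circle) f s = \int[mu]_(s in circle) g s.
Proof.
move=> mf mg f0 gf; rewrite /Rintegral; congr fine.
have g0 s : N s = 1 -> 0 <= g s.
  move=> s1; rewrite gf // mulr_ge0 ?f0 ?moebius_circle //.
  by apply: ltW; apply: poisson_factor_gt0; rewrite ?s1.
have mEf : measurable_fun (circle : set C) (EFin \o f) by apply/measurable_EFinP.
have mEg : measurable_fun (circle : set C) (EFin \o g) by apply/measurable_EFinP.
rewrite -[LHS]/(\int[mu]_(s in circle) (EFin \o f) s)%E.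
rewrite -[RHS]/(\int[mu]_(s in circle) (EFin \o g) s)%E.
rewrite (ge0_integral_orbit ti t1 mut mu0 mEf); last by move=> s s1; rewrite lee_fin f0.
rewrite (ge0_integral_orbit ti t1 mut mu0 mEg); last by move=> s s1; rewrite lee_fin g0.
rewrite (reindex_esum _ _ _ _ shift_bij); apply: eq_esum => n _.
by rewrite /= gf // -!EFinM cS -tS; congr EFin; ring.
Qed.

(** A bounded f becomes nonnegative after adding M, and the constant M is itself transformed into M
    D. Writing the factor as D, a real part of a kernel, makes it measurable and bounded. *)
Lemma Rintegral_moebius (f g : C -> R) (M : R) :
  measurable_fun (circle : set C) f -> measurable_fun (circle : set C) g ->
  (forall s : R[i], N s = 1 -> `|f s| <= M) ->
  (forall s : R[i], N s = 1 -> g s = poisson_factor b s * f (moebius e b s)) ->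
  \int[mu]_(s in circle) f s = \int[mu]_(s in circle) g s.
Proof.
move=> mf mg fM gf; have mc := @measurable_circle R.
have M0 : 0 <= M by apply: le_trans (fM 1 _); rewrite ?mod1.
pose D (s : C) := complex.Re (herglotz b s).
have DE s : N s = 1 -> poisson_factor b s = D s by exact: poisson_factor_herglotz.
have D0 s : N s = 1 -> 0 <= D s.
  by move=> s1; rewrite -DE // ltW // poisson_factor_gt0 // s1.
have mD : measurable_fun (circle : set C) D.
  by apply: measurable_fun_Re => s; exact: herglotz_continuous.
have DM s : N s = 1 -> D s <= 2 / (1 - N b).
  move=> s1; apply: le_trans (herglotz_bounded b1 s1).
  exact: le_trans (ler_norm _) (Re_le_mod _).
have mcst (k : R) : measurable_fun (circle : set C) (cst k : C -> R).
  exact: measurable_cst.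
have mMD : measurable_fun (circle : set C) (fun s : C => M * D s).
  exact: measurable_funM.
have I1 : \int[mu]_(s in circle) M = \int[mu]_(s in circle) (M * D s).
  apply: ge0_integral_moebius => //.
  by move=> s s1; rewrite DE // mulrC.
have I2 : \int[mu]_(s in circle) (f s + M) = \int[mu]_(s in circle) (g s + M * D s).
  apply: ge0_integral_moebius.
  - exact: measurable_funD.
  - exact: measurable_funD.
  - by move=> s /fM; rewrite ler_norml; lra.
  - by move=> s s1; rewrite gf // DE //; ring.
have if_ : mu.-integrable circle (EFin \o f).
  by apply: (@bounded_integrable_circle _ _ mu_fin _ M).
have ig : mu.-integrable circle (EFin \o g).
  apply: (@bounded_integrable_circle _ _ mu_fin _ (2 / (1 - N b) * M)) => // s s1.
  rewrite gf // DE // normrM ger0_norm ?D0 //.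
  by apply: ler_pM; rewrite ?D0 ?DM ?fM ?moebius_circle.
have iM : mu.-integrable circle (EFin \o (cst M : C -> R)).
  apply: (@bounded_integrable_circle _ _ mu_fin _ M) => // s _.
  by rewrite ger0_norm.
have iMD : mu.-integrable circle (EFin \o (fun s : C => M * D s)).
  apply: (@bounded_integrable_circle _ _ mu_fin _ (M * (2 / (1 - N b)))) => // s s1.
  by rewrite ger0_norm ?mulr_ge0 ?D0 // ler_wpM2l ?DM.
by move: I2; rewrite (RintegralD mc if_ iM) (RintegralD mc ig iMD) -I1 => /addIr.
Qed.

(** Read off from the covariance identity at z = 0, where both kernels are bounded on the circle. *)
Lemma herglotz_defect_bounded : exists M, forall s, N s = 1 ->
  N (herglotz_defect b s) <= M.
Proof.
have m0 : N (moebius e b 0) < 1 by apply: moebius_disc; rewrite ?mod0.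
exists (2 / (1 - N b) * (2 / (1 - N (moebius e b 0))) + 2 / (1 - N 0)) => s s1.
have N0 : N (0 : R[i]) < 1 by rewrite mod0.
have -> : herglotz_defect b s =
   (poisson_factor b s)%:C * herglotz (moebius e b 0) (moebius e b s) - herglotz 0 s.
  by rewrite (herglotz_moebius e1 b1 N0 s1) addrAC subrr add0r.
apply: (le_trans (modD _ _)); rewrite modN; apply: lerD; last exact: herglotz_bounded.
rewrite modM; apply: ler_pM; rewrite ?mod_ge0 //; last first.
  by apply: herglotz_bounded => //; exact: moebius_circle.
rewrite mod_real poisson_factor_herglotz //.
exact: le_trans (Re_le_mod _) (herglotz_bounded b1 s1).
Qed.

Lemma cintegral_herglotz_moebius (z : R[i]) : N z < 1 ->
  cintegral mu circle (herglotz (moebius e b z)) =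
  cintegral mu circle (herglotz z) + cintegral mu circle (herglotz_defect b).
Proof.
move=> z1; have mz1 := moebius_disc e1 b1 z1.
have [M defM] := herglotz_defect_bounded.
have hc (z' : R[i]) : N z' < 1 -> forall s, N s = 1 -> herglotz z' w @[w --> s] --> herglotz z' s.
  by move=> h s; exact: herglotz_continuous.
have hM (z' : R[i]) : N z' < 1 -> forall s, N s = 1 -> N (herglotz z' s) <= 2 / (1 - N z').
  by move=> h s; exact: herglotz_bounded.
have dc s : N s = 1 -> herglotz_defect b w @[w --> s] --> herglotz_defect b s.
  exact: herglotz_defect_continuous.
rewrite -(cintegralD mu_fin (hc z z1) dc (hM z z1) defM).
have sc s : N s = 1 -> (fun w => herglotz z w + herglotz_defect b w) w @[w --> s] -->
    herglotz z s + herglotz_defect b s.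
  by move=> s1; apply: cvgDC; [exact: hc|exact: dc].
rewrite /cintegral; congr (_ +i* _); apply: (@Rintegral_moebius _ _ (2 / (1 - N (moebius e b z)))).
- exact: measurable_fun_Re (hc _ mz1).
- exact: (measurable_fun_Re sc).
- by move=> s s1; exact: le_trans (Re_le_mod _) (hM _ mz1 _ s1).
- move=> s s1; rewrite -(herglotz_moebius e1 b1 z1 s1).
  by case: (herglotz _ _) => x y /=; rewrite mul0r subr0.
- exact: measurable_fun_Im (hc _ mz1).
- exact: (measurable_fun_Im sc).
- by move=> s s1; exact: le_trans (Im_le_mod _) (hM _ mz1 _ s1).
- move=> s s1; rewrite -(herglotz_moebius e1 b1 z1 s1).
  by case: (herglotz _ _) => x y /=; rewrite mul0r addr0.
Qed.

End TransferOfIntegrals.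

Theorem theorem3p8 (R : realType) (phi : R[i] -> R[i]) (a : R[i])
    (mu : {measure set (borelC R) -> \bar R})
    (phi_aut : disc_automorphism phi)
    (phi_nonelliptic : hyperbolic phi \/ parabolic phi)
    (a_circle : circle a)
    (phi_a : phi a <> a)
    (mu_circle : on_circle mu)
    (mu_point_finite : forall w : R[i], circle w -> (mu [set w] < +oo)%E)
    (mu_discrete : discrete_measure mu)
    (mu_atom : atom mu = Orb phi a) :
  singular_eigenfunction mu phi <->
  exists c : int -> R,
    [/\ 0 < c 0,
        forall n : nat, (1 <= n)%N ->
          c n%:Z = c 0 * \prod_(0 <= k < n)
            ComplexField.Normc.normc (derive1 phi (iterz phi k%:Z a)),
        forall n : nat, (1 <= n)%N ->
          c (- n%:Z) = c 0 / \prod_(1 <= k < n.+1)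
            ComplexField.Normc.normc (derive1 phi (iterz phi (- k%:Z) a)) &
        forall A : set (borelC R), measurable A ->
          mu A = (\esum_(n in [set: int])
                    ((c n)%:E * \d_(iterz phi n a : borelC R) A))%E].
Proof.
have [e [b [e1 b1 phiE dphi]]] := disc_automorphism_moebius phi_aut.
have a1 : N a = 1 by exact/circleE.
(* Non-ellipticity enters here, as a fixed point on the circle. *)
have [p p1 pp] : exists2 p : R[i], N p = 1 & moebius e b p = p.
  have [p [pc pp]] : exists p, circle p /\ phi p = p.
    case: phi_nonelliptic => [[_ [p [q [_ E]]]]|[_ [p E] _]]; exists p.
      by have /seteqP[_ H] := E; apply: H; left.
    by have /seteqP[_ H] := E; exact: H.
  by move/circleE: pc => p1; exists p => //; rewrite -phiE ?mod_le1.
pose t n := iterz phi n a.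
have t1 n : N (t n) = 1 by exact: iterz_circle e1 b1 phiE a n a1.
have tS n : t (n + 1) = moebius e b (t n).
  by rewrite /t (iterzS e1 b1 phiE) // phiE ?mod_le1 ?t1.
have t10 : t 1 != t 0 by apply/eqP.
have ti : injective t := orbit_inj e1 b1 p1 pp t1 tS t10.
have d0 n : 0 < poisson_factor b (t n) by rewrite poisson_factor_gt0 // t1.
have dE n : ComplexField.Normc.normc (derive1 phi (t n)) = poisson_factor b (t n).
  by rewrite dphi // mod_moebius_deriv.
have formulaE (c : int -> R) :
    (forall n, c (n + 1) = poisson_factor b (t n) * c n) <->
    (forall n : nat, (1 <= n)%N -> c n%:Z = c 0 * \prod_(0 <= k < n)
       ComplexField.Normc.normc (derive1 phi (iterz phi k%:Z a))) /\
    (forall n : nat, (1 <= n)%N -> c (- n%:Z) = c 0 / \prod_(1 <= k < n.+1)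
       ComplexField.Normc.normc (derive1 phi (iterz phi (- k%:Z) a))).
  have d0' n : 0 < ComplexField.Normc.normc (derive1 phi (t n)) by rewrite dE.
  have H := shift_recursion c d0'; split=> [h|h n].
    by apply: (iffLR H) => n; rewrite dE.
  by rewrite -dE; exact: (iffRL H h n).
have mc := @measurable_circle R.
split=> [[mu_fin [lambda eigen]]|[c [c0 cp cn cmu]]].
  pose c n := fine (mu [set t n]).
  have mut n : mu [set t n] = (c n)%:E.
    rewrite fineK // ge0_fin_numE ?measure_ge0 //.
    exact/mu_point_finite/circleE.
  have c_gt0 n : 0 < c n.
    rewrite -lte_fin -mut.
    by have [] : atom mu (t n) by rewrite mu_atom; exists n.
  have eigen' z : N z < 1 ->
      singular_function mu (moebius e b z) = lambda * singular_function mu z.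
    by move=> z1; rewrite -phiE ?ltW // -(eigen z) //; exact/discE.
  have cS n : c (n + 1) = poisson_factor b (t n) * c n.
    rewrite /c tS; apply: (atom_moebius mu_fin e1 b1 (t1 n)).
    exact: eigenfunction_poisson_integral eigen'.
  have mu0 : mu (circle `\` range t) = 0%E.
    have [A [cA _ A0]] := mu_discrete.
    have mA := measurable_countableC cA.
    (* The points of the carrier off the orbit are countably many, and none of them is an atom. *)
    have AO : mu (A `&` circle `\` range t) = 0%E.
      apply: countable_measure0; first by apply: sub_countable cA; apply: subset_card_le => z [[]].
      move=> w [[Aw cw] wO]; apply/eqP; rewrite eq_le measure_ge0 andbT leNgt.
      by apply/negP => w0; apply: wO; have : atom mu w by []; rewrite mu_atom.
    have mO := measurable_orbit t.
    have m1 : measurable (circle `\` A : set (borelC R)) by exact: measurableD.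
    have m2 : measurable (A `&` circle `\` range t : set (borelC R)).
      by apply: measurableD => //; exact: measurableI.
    have AB : mu ((circle `\` A) `|` (A `&` circle `\` range t)) = 0%E.
      by rewrite measureU0.
    apply: (subset_measure0 _ _ _ AB).
    - exact: measurableD.
    - exact: measurableU.
    - move=> z [zc zO]; have [Az|Az] := pselect (A z); [right|left]; by split.
  have [cp cn] := (iffLR (formulaE c)) cS.
  exists c; split=> // A mA.
  exact: (measure_orbit_supported ti mut mu0 mu_circle mA).
have cS := (iffRL (formulaE c)) (conj cp cn).
have c_gt0 : forall n, 0 < c n.
  by apply: int_shift_ind => // n; rewrite cS pmulr_rgt0.
(* The formula is evaluated at a singleton; injectivity of the orbit leaves the single term n. *)
have mut n : mu [set t n] = (c n)%:E.
  rewrite cmu; last exact: measurable_set1C.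
  rewrite (esumID [set n]) //; last by move=> m _; rewrite mule_ge0 ?lee_fin // ltW.
  rewrite setTI esum_set1; last by rewrite mule_ge0 ?lee_fin // ltW.
  rewrite diracE mem_set // mule1 esum1 ?adde0 // => m [_ mn].
  by rewrite diracE memNset ?mule0 // => /ti.
have mu0 : mu (circle `\` range t) = 0%E.
  rewrite cmu; last by apply: measurableD => //; exact: measurable_orbit.
  apply: esum1 => n _; rewrite diracE memNset ?mule0 // => -[_]; apply.
  by exists n.
have mu_fin : (mu circle < +oo)%E.
  rewrite cmu //; have := orbit_weights_summable e1 b1 p1 pp t1 tS t10 c_gt0 cS.
  apply: le_lt_trans; apply: le_esum => n _; rewrite diracE mem_set ?mule1 //.
  exact/circleE/t1.
(* The additive constant of the Herglotz integral becomes the eigenvalue. *)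
split=> //; exists (cexp (- cintegral mu circle (herglotz_defect b))) => z /discE z1.
rewrite /composition /= phiE ?ltW // /singular_function -cexpD.
have -> := cintegral_herglotz_moebius e1 b1 ti t1 tS cS mut mu0 mu_fin z1.
by rewrite opprD addrC.
Qed.
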